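(* There is a universal constant $C>0$ such that the following holds. Consider any $K$-armed bandit problem ($K\ge2$) whose reward distributions all belong to a known one-parameter exponential family $\mathcal F_m$ such that the log-partition function $b$ is twice differentiable with continuous second derivative $b''>0$ on $\Theta$, and such that every distribution in $\mathcal F_m$ has variance at most $\bar V$. Then the algorithm Exp-KL-MS, run for $T$ rounds, satisfies $$\mathrm{Reg}(T)\le C\sum_{a\in[K]:\Delta_a>0}\Big(\frac{\bar V\ln T}{\Delta_a}+\Delta_a\Big),$$ where $\Delta_a=\mu_{\max}-\mu_a$.
   Context: Exponential family: given a base measure $m$ on $\mathbb R$, $\mathcal F_m=\{p_\theta(dx)=m(dx)\exp(x\theta-b(\theta)):\theta\in\Theta\}$, where $\Theta\subset\mathbb R$ is an interval and $b(\theta)=\ln\int_{\mathbb R}e^{x\theta}m(dx)$. Members are determined by their mean $b'(\theta)$. $\mathrm{KL}(\mu,\mu')$ denotes the Kullback–Leibler divergence $\mathbb E_{X\sim\nu}[\ln\frac{d\nu}{d\nu'}(X)]$ between the members $\nu,\nu'$ of $\mathcal F_m$ with means $\mu,\mu'$. Bandit: each arm $a\in[K]=\{1,\dots,K\}$ has reward distribution $\nu_a\in\mathcal F_m$ with mean $\mu_a$; $\mu_{\max}=\max_a\mu_a$. In round $t=1,\dots,T$ the agent picks $I_t\in[K]$ (based on the past and internal randomness) and receives $r_t\sim\nu_{I_t}$, independent of the past given $I_t$. $N_{t,a}=\sum_{i\le t}\mathbf 1\{I_i=a\}$, $\hat\mu_{t,a}=\frac1{N_{t,a}}\sum_{i\le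 t}r_i\mathbf 1\{I_i=a\}$, $\hat\mu_{t,\max}=\max_a\hat\mu_{t,a}$. It is assumed that empirical means are means of members of $\mathcal F_m$. Regret: $\mathrm{Reg}(T)=\mathbb E\big[\sum_{t=1}^T(\mu_{\max}-\mu_{I_t})\big]$. Exp-KL-MS: in rounds $t\le K$ pull $I_t=t$; in each round $t>K$ pull $I_t=a$ with probability $p_{t,a}=\exp\!\big(-L(N_{t-1,a})\,\mathrm{KL}(\hat\mu_{t-1,a},\hat\mu_{t-1,\max})\big)/M_t$, where $L(k)=k-1$ and $M_t$ normalizes the probabilities to sum to $1$. *)

(* Defs.v *)
From HB Require Import structures.
From mathcomp Require Import all_boot all_order all_algebra.
From mathcomp Require Import all_classical all_reals all_analysis.
From mathcomp Require Import measurable_realfun.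

(* MathComp-Analysis.  Rounds are numbered 1, 2, ..., T as natural numbers; the
   arms 1, ..., K are the elements of 'I_K, so that a : 'I_K is arm a.+1. *)

Set Implicit Arguments.
Unset Strict Implicit.
Unset Printing Implicit Defensive.

Import Order.TTheory GRing.Theory Num.Theory.
Import numFieldNormedType.Exports.

Local Open Scope classical_set_scope.
Local Open Scope ring_scope.
Local Open Scope charge_scope.

Section exponential_family.
Context {R : realType}.
Implicit Types (m : {measure set R -> \bar R}) (Theta : set R) (theta : R).

Definition partition_fun m theta : \bar R :=
  (\int[m]_x (expR (x * theta))%:E)%E.

Definition log_partition m theta : R := ln (fine (partition_fun m theta)).

Definition tilt m theta (A : set R) : \bar R :=
  (\int[m]_(x in A) (expR (x * theta - log_partition m theta))%:E)%E.

Let tilt0 m theta : tilt m theta set0 = 0%E.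
Proof. exact: integral_set0. Qed.

Let tilt_ge0 m theta A : (0 <= tilt m theta A)%E.
Proof. by apply: integral_ge0 => x _; rewrite lee_fin expR_ge0. Qed.

Let measurable_tilt m theta (D : set R) : measurable_fun D
  (EFin \o (fun x => expR (x * theta - log_partition m theta))).
Proof.
apply: measurable_funTS; apply/measurable_EFinP.
apply: measurableT_comp; first exact: measurable_expR.
by apply: measurable_funB => //; apply: measurable_funM.
Qed.

Let tilt_sigma_additive m theta : semi_sigma_additive (tilt m theta).
Proof.
move=> /= F mF tF mUF; rewrite /tilt; apply: cvg_toP.
  apply: ereal_nondecreasing_is_cvgn => i j ij.
  apply: lee_sum_nneg_natr => // k _ _; apply: integral_ge0 => x _.
  by rewrite lee_fin expR_ge0.
rewrite ge0_integral_bigcup//=; first exact: measurable_tilt.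
Qed.

HB.instance Definition _ m theta := isMeasure.Build _ _ _ (tilt m theta)
  (tilt0 m theta) (tilt_ge0 m theta) (@tilt_sigma_additive m theta).

(* [tilt m theta] already has total mass 1 when the partition function is
   finite and positive at [theta] (see [expfamE]); [mnormalize] only serves to
   obtain a total function into [probability R R], the Dirac mass being the
   value for the other parameters. *)
Definition expfam m theta : probability R R :=
  mnormalize (tilt m theta) \d_(0 : R).

(* [m] and [Theta] define an exponential family; the last two conditions say
   that the log-partition function is real-valued on [Theta]. *)
Definition is_expfam m Theta : Prop :=
  is_interval Theta /\
  forall theta, Theta theta -> (0 < partition_fun m theta < +oo)%E.

Lemma expfamE m Theta theta (A : set R) :
  is_expfam m Theta -> Theta theta -> measurable A ->
  expfam m theta A = tilt m theta A.
Proof.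
move=> [_ /(_ theta) mT] Tt mA; have /andP[Z0 Zoo] := mT Tt.
have ZE : partition_fun m theta = (fine (partition_fun m theta))%:E.
  by rewrite fineK// fin_numElt Zoo (lt_trans _ Z0).
have Zp : 0 < fine (partition_fun m theta) by rewrite fine_gt0// Z0.
have t1 : tilt m theta setT = 1%E.
  rewrite /tilt; under eq_integral do rewrite expRD mulrC EFinM.
  rewrite ge0_integralZl//=; last first.
    apply/measurable_EFinP; apply: measurableT_comp; first exact: measurable_expR.
    exact: measurable_funM.
  rewrite -/(partition_fun m theta) ZE /log_partition expRN lnK ?posrE//.
  by rewrite -EFinM mulVf// gt_eqF.
by rewrite /expfam /= /mnormalize /= t1 eqe oner_eq0 /= invr1 mule1.
Qed.

Definition expfam_set m Theta : set (probability R R) := expfam m @` Theta.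

Definition mean (nu : probability R R) : R := fine 'E_nu[id].

(* Kullback-Leibler divergence of [nu] from [nu'], through the Radon-Nikodym
   derivative, which is meaningful only when [nu] is dominated by [nu']. *)
Definition KLdiv (nu nu' : probability R R) : \bar R :=
  if `[< nu `<< nu' >] then
    (\int[nu]_x lne (('d (charge_of_finite_measure nu) '/d nu') x))%E
  else +oo%E.

(* The member of the family with mean [x]. *)
Definition expfam_of_mean m Theta (x : R) : probability R R :=
  expfam m (get [set theta | Theta theta /\ mean (expfam m theta) = x]).

(* KL as a function of the means, always finite between two members of an
   exponential family whose means are finite. *)
Definition KL m Theta (x y : R) : R :=
  fine (KLdiv (expfam_of_mean m Theta x) (expfam_of_mean m Theta y)).

(* Derivative on a set that need not be open: one-sided at an endpoint of an
   interval [D], the usual derivative in its interior. *)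
Definition derivative_within (D : set R) (f f' : R -> R) : Prop :=
  forall x, D x ->
    (f y - f x) / (y - x) @[y --> within D x^'] --> f' x.

Definition C2_pos_within (D : set R) (f : R -> R) : Prop :=
  exists f' f'' : R -> R,
    [/\ derivative_within D f f', derivative_within D f' f'',
        {within D, continuous f''} & forall x, D x -> 0 < f'' x].

End exponential_family.

(* [head 0 (codom f)] is a neutral value, irrelevant when [J] is nonempty. *)
Definition fin_max {R : realType} (J : finType) (f : J -> R) : R :=
  \big[Num.max/head 0 (codom f)]_(x <- codom f) x.

Lemma fin_maxP {R : realType} (J : finType) (f : J -> R) (j0 : J) :
  (forall j, f j <= fin_max f) /\ (exists j, fin_max f = f j).
Proof.
have j0f : f j0 \in codom f by exact: codom_f.
split=> [j|].
  by rewrite /fin_max; apply: le_bigmax_seq => //; exact: codom_f.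
suff /codomP : fin_max f \in codom f by [].
rewrite /fin_max; move: j0f; case: (codom f) => // x s _ /=.
rewrite big_seq; elim/big_ind : _ => //; first by rewrite mem_head.
by move=> y z ys zs; case: leP.
Qed.

Section bandit.
Context {R : realType} (d : measure_display) (Omega : measurableType d).
Context (P : probability Omega R) (K : nat).
Variables (I : nat -> Omega -> 'I_K) (r : nat -> Omega -> R).
Implicit Types (t T : nat) (a : 'I_K) (nu : 'I_K -> probability R R).

(* The sigma-algebra generated by I_s and r_s for 1 <= s < t. *)
Definition history t : set_system Omega :=
  <<s [set A | exists2 s, (1 <= s < t)%N &
         (exists a, A = I s @^-1` [set a]) \/
         (exists2 B : set R, measurable B & A = r s @^-1` B)] >>.

(* I_1, ..., I_T, r_1, ..., r_T are random variables and, given the history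
   before round t and I_t, the reward r_t has law nu_(I_t). *)
Definition bandit_interaction nu T : Prop :=
  forall t, (1 <= t <= T)%N ->
    [/\ forall a, measurable (I t @^-1` [set a]),
        measurable_fun setT (r t) &
        forall E a (B : set R), history t E -> measurable B ->
          P (E `&` I t @^-1` [set a] `&` r t @^-1` B) =
          (P (E `&` I t @^-1` [set a]) * nu a B)%E].

(* [p t a] is the conditional probability of I_t = a given the history before
   round t. *)
Definition follows_policy (p : nat -> 'I_K -> Omega -> R) T : Prop :=
  forall t, (1 <= t <= T)%N -> forall E a, history t E ->
    P (E `&` I t @^-1` [set a]) = (\int[P]_(w in E) (p t a w)%:E)%E.

Definition pulls t a (w : Omega) : nat :=
  (\sum_(1 <= s < t.+1) (I s w == a))%N.

Definition emp_mean t a (w : Omega) : R :=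
  (\sum_(1 <= s < t.+1 | I s w == a) r s w) / (pulls t a w)%:R.

Definition emp_max t (w : Omega) : R := fin_max (fun a => emp_mean t a w).

(* Empirical means are means of members of the family; almost surely, for the
   arms that have been pulled. *)
Definition emp_means_in_family m (Theta : set R) T : Prop :=
  forall t a, (1 <= t <= T)%N ->
    {ae P, forall w, (0 < pulls t a w)%N ->
      exists2 nu, expfam_set m Theta nu & mean nu = emp_mean t a w}.

Definition gap nu a : R := fin_max (fun c => mean (nu c)) - mean (nu a).

Definition regret nu T : \bar R :=
  'E_P[fun w => \sum_(1 <= t < T.+1) gap nu (I t w)].

Definition klms_L (k : nat) : R := k%:R - 1.

Definition exp_kl_weight m (Theta : set R) t a (w : Omega) : R :=
  expR (- (klms_L (pulls t.-1 a w) *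
           KL m Theta (emp_mean t.-1 a w) (emp_max t.-1 w))).

Definition exp_kl_ms m (Theta : set R) t a (w : Omega) : R :=
  if (t <= K)%N then (a.+1 == t)%:R
  else exp_kl_weight m Theta t a w / \sum_c exp_kl_weight m Theta t c w.

End bandit.

(* Main.v *)
Require Import Defs.
From mathcomp Require Import all_boot all_order all_algebra.
From mathcomp Require Import all_classical all_reals all_analysis.
From mathcomp Require Import measurable_realfun.
From mathcomp Require Import ring lra zify.

(* Fix a suboptimal arm [a] with gap D and an optimal arm [c], and let [x], [y]
   be the means at distance D/4 from those of [a] and [c], on the inner side.
   In natural parameters the KL divergence is the Bregman divergence of the
   log-partition function; the variance bound makes the mean a Lipschitz
   function of the parameter, hence KL >= (difference of means)^2 / (8 V), so
   that each divergence below is at least q = D^2 / (128 V).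

   After the initial rounds, a pull of [a] is of one of four kinds.
   - [a] was pulled fewer than u ~ ln T / q times.
   - Otherwise, the empirical mean of [a] is at most [x] and the largest
     empirical mean is at least [y]: the policy gives [a] probability <= 1/T.
   - The empirical mean of [a] exceeds [x]: by Markov's inequality for the
     likelihood ratio after k pulls this happens with probability
     <= exp (- k q) for each k.
   - The largest empirical mean is below [y].  Then the policy pulls [a] at most
     exp (k KL(mean of c, largest mean)) times as often as [c], where k counts
     the pulls of [c].  Cut according to the integer part j of k times the
     divergence from the empirical to the true mean of [c]: layer j costs a
     factor exp (j + 1 - k q), and a likelihood ratio shows that the number of
     pulls of [c] in that layer has expectation <= exp (- j).  Only
     j < 2 ln T matters, and the sum over j and k is O(ln T / q).

   The likelihood ratio is controlled along the first k pulls of an arm by a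
   product of conditionally normalized factors, with no independence beyond the
   conditional law of a reward given the history. *)

Set Implicit Arguments.
Unset Strict Implicit.
Unset Printing Implicit Defensive.

Import Order.TTheory GRing.Theory Num.Theory.
Import numFieldNormedType.Exports.
Local Open Scope classical_set_scope.
Local Open Scope ring_scope.

(** * Integration against a measure that is the image of a density *)

Section integral_against_a_density.
Local Open Scope ereal_scope.
Context {d1 d2 : measure_display} {T1 : measurableType d1} {T2 : measurableType d2}.
Context {R : realType}.
Variables (mu : {measure set T1 -> \bar R}) (nu : {measure set T2 -> \bar R}).
Variables (phi : T1 -> T2) (f : T1 -> R).
Hypothesis mphi : measurable_fun setT phi.
Hypothesis mf : measurable_fun setT f.
Hypothesis f0 : forall x, (0 <= f x)%R.
Hypothesis nuE : forall A, measurable A ->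
  nu A = \int[mu]_(x in phi @^-1` A) (f x)%:E.

Import HBNNSimple.

(** Monotone convergence reduces the claim to simple functions and then to indicators, where it is
    [nuE]. With [phi] the identity this changes the parameter of the family; with [phi] a reward it
    expresses the conditional law of that reward. *)
Lemma ge0_integral_density (g : T2 -> \bar R) :
  (forall y, 0 <= g y) -> measurable_fun setT g ->
  \int[nu]_y g y = \int[mu]_x (g (phi x) * (f x)%:E).
Proof.
move=> g0 mg.
have mEf : measurable_fun setT (EFin \o f) by exact/measurable_EFinP.
have mpre A : measurable A -> measurable (phi @^-1` A).
  by move=> mA; rewrite -[X in measurable X]setTI; exact: mphi.
pose h := nnsfun_approx measurableT mg.
have gE y : g y = limn (fun n => (h n y)%:E).
  by apply/esym/cvg_lim => //; exact: cvg_nnsfun_approx.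
under eq_integral do rewrite gE.
rewrite monotone_convergence//; last 3 first.
- by move=> n; exact/measurable_EFinP/measurable_funP.
- by move=> n x _; rewrite lee_fin.
- by move=> x _ a b ab; rewrite lee_fin; exact/lefP/nd_nnsfun_approx.
have gfE x : g (phi x) * (f x)%:E = limn (fun n => (h n (phi x) * f x)%:E).
  apply/esym/cvg_lim => //; under eq_fun do rewrite EFinM.
  by apply: cvgeZr => //; exact: cvg_nnsfun_approx.
under [RHS]eq_integral do rewrite gfE.
rewrite monotone_convergence//; last 3 first.
- move=> n; apply/measurable_EFinP; apply: measurable_funM => //.
  by apply: measurableT_comp mphi; exact: measurable_funP.
- by move=> n x _; rewrite lee_fin mulr_ge0.
- move=> x _ a b ab; rewrite lee_fin ler_wpM2r//.
  exact/lefP/nd_nnsfun_approx.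
congr (limn _); apply/funext => n.
have hE y : (h n y)%:E =
    \sum_(z \in range (h n)) (z * \1_(h n @^-1` [set z]) y)%:E.
  by rewrite fsumEFin// -fimfunE.
have hfE x : (h n (phi x) * f x)%:E =
    \sum_(z \in range (h n)) ((z * \1_(h n @^-1` [set z]) (phi x))%:E * (f x)%:E).
  rewrite EFinM hE ge0_mule_fsuml// => z; exact: nnfun_muleindic_ge0.
under eq_integral do rewrite hE.
under [RHS]eq_integral do rewrite hfE.
have mind z : measurable_fun setT
    (fun y => (z * \1_(h n @^-1` [set z]) y)%:E : \bar R).
  by apply/measurable_EFinP; apply: measurable_funM.
rewrite ge0_integral_fsum//; last by move=> z y _; exact: nnfun_muleindic_ge0.
rewrite ge0_integral_fsum//; last 2 first.
- move=> z; apply: emeasurable_funM => //.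
  exact: (measurableT_comp (mind z) mphi).
- move=> z x _; apply: mule_ge0; last by rewrite lee_fin.
  exact: nnfun_muleindic_ge0.
apply: eq_fsbigr => z zh.
have z0 : (0 <= z)%R by move: zh; rewrite inE => -[t _ <-].
set A := h n @^-1` _; have mA : measurable A.
  by rewrite -[A]setTI; apply: (measurable_funP (h n)).
under eq_integral do rewrite EFinM.
rewrite ge0_integralZl//; last exact/measurable_EFinP.
rewrite integral_indic// setIT nuE//.
under [RHS]eq_integral do rewrite EFinM -muleA.
rewrite ge0_integralZl//; last 2 first.
- apply: emeasurable_funM => //; apply/measurable_EFinP.
  exact: (measurableT_comp _ mphi).
- by move=> x _; rewrite mule_ge0// lee_fin.
congr (_ * _); rewrite integral_mkcond.
apply: eq_integral => x _; rewrite patchE indicE.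
have -> : (phi x \in A) = (x \in phi @^-1` A) by apply/idP/idP; rewrite !inE.
by case: ifPn => _; rewrite ?mul1e ?mul0e.
Qed.

Lemma integral_density (g : T2 -> \bar R) : measurable_fun setT g ->
  \int[nu]_y g y = \int[mu]_x (g (phi x) * (f x)%:E).
Proof.
move=> mg; rewrite integralE ge0_integral_density//; last exact: measurable_funepos.
rewrite ge0_integral_density//; last exact: measurable_funeneg.
rewrite [RHS]integralE; congr (_ - _); apply: eq_integral => x _.
- by rewrite !funeposE -[0 in RHS](mul0e (f x)%:E) -maxe_pMl// lee_fin.
- by rewrite !funenegE -mulNe -[0 in RHS](mul0e (f x)%:E) -maxe_pMl// lee_fin.
Qed.

End integral_against_a_density.

Lemma lipschitz_ivt {R : realType} (f : R -> R) (x y L v : R) :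
  x <= y ->
  (forall s t, x <= s -> s <= t -> t <= y -> `|f t - f s| <= L * (t - s)) ->
  Num.min (f x) (f y) <= v <= Num.max (f x) (f y) ->
  exists2 c, x <= c <= y & f c = v.
Proof.
move=> xy fL vxy; suff fc : {within `[x, y], continuous f}.
  by have [c] := IVT xy fc vxy; rewrite in_itv /=; exists c.
(* Nothing makes [L] positive, so it is replaced by [|L| + 1], by which one can divide. *)
have {}fL s t : x <= s <= y -> x <= t <= y -> `|f s - f t| <= (`|L| + 1) * `|s - t|.
  wlog st : s t / t <= s => [H sxy txy|/andP[_ sy] /andP[xt _]].
    have [ts|/ltW st] := leP t s; first exact: H.
    by rewrite distrC [`|s - t|]distrC; exact: H.
  rewrite (le_trans (fL _ _ xt st sy))// [`|s - t|]ger0_norm ?subr_ge0//.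
  by rewrite ler_wpM2r ?subr_ge0// (le_trans (ler_norm L))// lerDl.
apply/subspace_continuousP => s; rewrite /= in_itv /= => sxy.
apply/cvgrPdist_le => e e0; rewrite near_withinE.
have L0 : 0 < `|L| + 1 by rewrite ltr_wpDl.
near=> t => /=; rewrite in_itv /= => txy; rewrite (le_trans (fL _ _ sxy txy))//.
rewrite mulrC -ler_pdivlMr//; near: t.
apply: cvgr_dist_le; [exact: cvg_id|exact: divr_gt0].
Unshelve. all: by end_near. Qed.

Lemma expR_tilt {R : realType} (x y y' c c' : R) : expR (x * y' - c') =
  expR (x * (y' - y) - (c' - c)) * expR (x * y - c).
Proof. by rewrite -expRD; congr expR; ring. Qed.

(** * Convex potentials: the mean map and the Bregman divergence *)

Section convex_potential.
Context {R : realType} (Theta : set R) (b mu : R -> R) (V : R).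
Hypothesis Theta_itv : forall x y z, Theta x -> Theta y -> x <= z <= y -> Theta z.
Hypothesis mu_subgradient : forall th th', Theta th -> Theta th' ->
  (th' - th) * mu th <= b th' - b th.
Hypothesis mu_lipschitz0 : forall th th', Theta th -> Theta th' -> th <= th' ->
  mu th' - mu th <= (th' - th) * (2 * V + (mu th' - mu th) ^+ 2).
Implicit Types th : R.

Lemma mu_nondecreasing th th' : Theta th -> Theta th' -> th <= th' ->
  mu th <= mu th'.
Proof.
move=> Tth Tth'; rewrite le_eqVlt => /predU1P[->//|h].
have := mu_subgradient Tth Tth'; have := mu_subgradient Tth' Tth.
by move: h; rewrite -subr_gt0; nra.
Qed.

Let convex_mid th th' : Theta th -> Theta th' -> th <= th' ->
  Theta ((th + th') / 2).
Proof.
by move=> Tth Tth' h; apply: (Theta_itv Tth Tth'); apply/andP; split; lra.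
Qed.

(* Splitting [th, th'] in halves kills the quadratic term in the limit. *)
Lemma mu_lipschitz th th' : Theta th -> Theta th' -> th <= th' ->
  mu th' - mu th <= 2 * V * (th' - th).
Proof.
have halving n : forall th th', Theta th -> Theta th' -> th <= th' ->
    mu th' - mu th <= (th' - th) * (2 * V + (mu th' - mu th) ^+ 2 / 2 ^+ n).
  elim: n => [|n IH] {}th {}th' Tth Tth' h.
    by rewrite expr0 divr1; exact: mu_lipschitz0.
  have Tc := convex_mid Tth Tth' h; set c := (th + th') / 2 in Tc.
  have c1 : th <= c by rewrite /c; lra.
  have c2 : c <= th' by rewrite /c; lra.
  have {IH} := (IH _ _ Tth Tc c1, IH _ _ Tc Tth' c2).
  have {c1 c2} := (mu_nondecreasing Tth Tc c1, mu_nondecreasing Tc Tth' c2).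
  have -> : c - th = (th' - th) / 2 by rewrite /c; field.
  have -> : th' - c = (th' - th) / 2 by rewrite /c; field.
  have q0 : 0 < (2 ^+ n : R)^-1 by rewrite invr_gt0 exprn_gt0.
  rewrite [2 ^+ n.+1]exprS invfM; set q := (_ ^+ n)^-1 in q0 *.
  set x := mu th; set y := mu c; set z := mu th'.
  move=> [xy yz] [H1 H2].
  have hq : 0 <= (th' - th) * q by rewrite mulr_ge0 ?subr_ge0// ltW.
  (* The squares of the two increments add up to at most the square of the total increment. This
     cross term is the difference, and the halved length supplies the new factor 1/2. *)
  have H3 : 0 <= (th' - th) * q * ((y - x) * (z - y)).
    by rewrite mulr_ge0// mulr_ge0 ?subr_ge0.
  nra.
move=> Tth Tth' h; rewrite -subr_le0; apply/ler_addgt0Pr => e e0; rewrite add0r.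
set D := mu th' - mu th; set K := (th' - th) * D ^+ 2.
have K0 : 0 <= K by rewrite mulr_ge0 ?sqr_ge0 ?subr_ge0.
have [n Kn] : exists n, K / e < 2 ^+ n.
  exists (Num.bound (K / e)); have Ke : 0 <= K / e by rewrite divr_ge0// ltW.
  rewrite (lt_trans (archi_boundP Ke))//.
  by rewrite -natrX ltr_nat ltn_expl.
have := halving n _ _ Tth Tth' h; rewrite -/D mulrDr [X in _ + X]mulrA -/K.
have : K / 2 ^+ n <= e.
  by rewrite ler_pdivrMr ?exprn_gt0// mulrC -ler_pdivrMr// ltW.
lra.
Qed.

Lemma mu_ivt th th' v : Theta th -> Theta th' -> th <= th' ->
  mu th <= v <= mu th' ->
  exists c, [/\ Theta c, th <= c <= th' & mu c = v].
Proof.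
move=> Tth Tth' h hv; have inT s : th <= s -> s <= th' -> Theta s.
  by move=> s1 s2; apply: (Theta_itv Tth Tth'); rewrite s1.
have [||c cth cv] := @lipschitz_ivt _ mu th th' (2 * V) v h.
- move=> s t s1 st t1; have Ts := inT _ s1 (le_trans st t1).
  have Tt := inT _ (le_trans s1 st) t1.
  by rewrite ger0_norm ?subr_ge0; [exact: mu_lipschitz|exact: mu_nondecreasing].
- have mm := mu_nondecreasing Tth Tth' h.
  by rewrite min_l// max_r.
- by exists c; split => //; case/andP: cth; exact: inT.
Qed.

(* For [b] the log-partition function and [mu] the mean: the Kullback-Leibler
   divergence in natural parameters. *)
Definition bregman th ph : R := (th - ph) * mu th - b th + b ph.

Lemma bregman_ge0 th ph : Theta th -> Theta ph -> 0 <= bregman th ph.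
Proof.
by move=> Tth Tph; have := mu_subgradient Tth Tph; rewrite /bregman; lra.
Qed.

Lemma bregmanxx th : bregman th th = 0.
Proof. by rewrite /bregman; ring. Qed.

(** The right side exceeds the left by [(z - y) * (mu y - mu x)], which is nonnegative by
    monotonicity of [mu]. *)
Lemma bregman_three_point x y z : Theta x -> Theta y -> Theta z ->
  x <= y -> y <= z -> bregman x y + bregman y z <= bregman x z.
Proof.
move=> Tx Ty Tz xy yz; have := mu_nondecreasing Tx Ty xy.
by rewrite /bregman; nra.
Qed.

(* Go through the parameter at distance [|mu th - mu ph| / (4 V)] from [ph],
   whose mean is still half the way to [mu ph]. *)
Lemma bregman_ge th ph : Theta th -> Theta ph -> 0 < V ->
  (mu th - mu ph) ^+ 2 / (8 * V) <= bregman th ph.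
Proof.
move=> Tth Tph V0.
have V4 : 0 < 4 * V by lra.
have V8 : 0 < 8 * V by lra.
rewrite ler_pdivrMr//.
have [h|h] := leP th ph.
- have d0 := mu_nondecreasing Tth Tph h.
  have dL := mu_lipschitz Tth Tph h.
  pose s := ph - (mu ph - mu th) / (4 * V).
  have sE : (ph - s) * (4 * V) = mu ph - mu th.
    by rewrite /s opprB addrC subrK divfK// gt_eqF.
  have sph : s <= ph by rewrite -subr_ge0 -(pmulr_lge0 _ V4) sE subr_ge0.
  have ths : th <= s.
    rewrite -subr_ge0 -(pmulr_lge0 _ V4).
    have -> : (s - th) * (4 * V) = (ph - th) * (4 * V) - (ph - s) * (4 * V) by ring.
    rewrite sE; have : 0 <= (ph - th) * V by rewrite mulr_ge0 ?subr_ge0// ltW.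
    lra.
  have Ts : Theta s by apply: (Theta_itv Tth Tph); rewrite ths sph.
  have := mu_lipschitz Ts Tph sph.
  have := mu_subgradient Ts Tph; have := mu_subgradient Tth Ts.
  rewrite /bregman => B1 B2 L.
  (* The subgradient inequalities on the two sides of [s] leave below the divergence a rectangle of
     width [ph - s] and height [mu s - mu th]; by [L] this height is at least half of
     [mu ph - mu th]. *)
  have B3 : (ph - s) * (mu s - mu th) <= (th - ph) * mu th - b th + b ph by nra.
  have L2 : (mu ph - mu th) / 2 <= mu s - mu th by nra.
  have := ler_wpM2r (ltW V8) B3; apply: le_trans.
  have ps : 0 <= (ph - s) * (4 * V) by rewrite sE; lra.
  have := ler_wpM2l ps L2; rewrite {1}sE; nra.
(* Mirror image of the previous case, with [s] above [ph]. *)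
- have {}h := ltW h.
  have d0 := mu_nondecreasing Tph Tth h.
  have dL := mu_lipschitz Tph Tth h.
  pose s := ph + (mu th - mu ph) / (4 * V).
  have sE : (s - ph) * (4 * V) = mu th - mu ph.
    by rewrite /s addrAC subrr add0r divfK// gt_eqF.
  have sph : ph <= s by rewrite -subr_ge0 -(pmulr_lge0 _ V4) sE subr_ge0.
  have ths : s <= th.
    rewrite -subr_ge0 -(pmulr_lge0 _ V4).
    have -> : (th - s) * (4 * V) = (th - ph) * (4 * V) - (s - ph) * (4 * V) by ring.
    rewrite sE; have : 0 <= (th - ph) * V by rewrite mulr_ge0 ?subr_ge0// ltW.
    lra.
  have Ts : Theta s by apply: (Theta_itv Tph Tth); rewrite ths sph.
  have := mu_lipschitz Tph Ts sph.
  have := mu_subgradient Ts Tph; have := mu_subgradient Tth Ts.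
  rewrite /bregman => B1 B2 L.
  have B3 : (s - ph) * (mu th - mu s) <= (th - ph) * mu th - b th + b ph by nra.
  have L2 : (mu th - mu ph) / 2 <= mu th - mu s by nra.
  have := ler_wpM2r (ltW V8) B3; apply: le_trans.
  have ps : 0 <= (s - ph) * (4 * V) by rewrite sE; lra.
  have := ler_wpM2l ps L2; rewrite {1}sE; nra.
Qed.

(* Likelihood-ratio form of the lower tail: whenever the mean of [ph <= th] is so
   low that [bregman ph th >= D], the log-likelihood ratio of the fixed
   parameter [ps] against [th], evaluated at that mean, is at least [D]. *)
Lemma bregman_level th (D : R) : Theta th -> 0 < V -> 0 <= D ->
  exists ps, [/\ Theta ps, (D = 0 -> ps = th) &
    forall ph, Theta ph -> ph <= th -> D <= bregman ph th ->
      D <= (ps - th) * mu ph - (b ps - b th)].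
Proof.
move=> Tth V0; rewrite le_eqVlt => /predU1P[<-|D0].
  by exists th; split => // ph _ _ _; rewrite !subrr mul0r subr0.
have Dn P : D = 0 -> P by move=> D0'; rewrite D0' ltxx in D0.
have [[ph0 [Tph0 ph0th Dph0]]|noD] :=
    pselect (exists ph, [/\ Theta ph, ph <= th & D <= bregman ph th]); last first.
  (* No parameter below [th] reaches the level [D], so the last condition is vacuous. *)
  exists th; split => // ph Tph phth Dph; exfalso; apply: noD.
  by exists ph.
have inT s : ph0 <= s -> s <= th -> Theta s.
  by move=> s1 s2; apply: (Theta_itv Tph0 Tth); rewrite s1.
(* [ps] is a parameter whose divergence to [th] is exactly [D]. The Lipschitz constant comes from
   [bregman s th - bregman t th <= (th - s) * (mu t - mu s)]. *)
have [||ps /andP[ps1 ps2] psD] := @lipschitz_ivt _ (fun ph => bregman ph th) ph0 th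
  (2 * V * (th - ph0)) D ph0th.
- move=> s t s1 st t1; have Ts := inT _ s1 (le_trans st t1).
  have Tt := inT _ (le_trans s1 st) t1.
  have tp := bregman_three_point Ts Tt Tth st t1.
  have ml := mu_lipschitz Ts Tt st.
  have b0 := bregman_ge0 Ts Tt; have b1 := mu_subgradient Tt Ts.
  rewrite distrC ger0_norm; last lra.
  have e1 : bregman s th - bregman t th =
     bregman s t + (th - t) * (mu t - mu s) by rewrite /bregman; ring.
  have e2 : bregman s t <= (t - s) * (mu t - mu s) by rewrite /bregman; lra.
  have e3 : (th - s) * (mu t - mu s) <= (th - ph0) * (2 * V * (t - s)).
    apply: ler_pM => //; last lra; first by rewrite subr_ge0 (le_trans st).
    by rewrite subr_ge0 mu_nondecreasing.
  by rewrite e1; nra.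
- rewrite bregmanxx min_r ?bregman_ge0// max_l ?bregman_ge0//.
  by rewrite (ltW D0).
have Tps := inT _ ps1 ps2.
exists ps; split => [//||ph Tph phth Dph]; first exact: Dn.
(* If [ph <= ps], the log-likelihood ratio of [ps] against [th] is nonincreasing in the mean and
   equals [D] at [mu ps]. *)
have [phps|psph] := leP ph ps.
  have := mu_nondecreasing Tph Tps phps.
  by move: psD; rewrite /bregman; nra.
(* If [ps < ph], the three-point inequality forces [bregman ps ph <= 0], so that [ps] and [ph] have
   the same mean. *)
have tp := bregman_three_point Tps Tph Tth (ltW psph) phth.
have b0 := bregman_ge Tps Tph V0.
have : (mu ps - mu ph) ^+ 2 <= 0.
  by move: b0; rewrite ler_pdivrMr; nra.
rewrite real_exprn_even_le0 ?num_real//= subr_eq0 => /eqP muE.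
by move: Dph; rewrite -psD /bregman -muE; nra.
Qed.

End convex_potential.

(** * Exponential families *)

Section exponential_family_moments.
Context {R : realType} (m : {measure set R -> \bar R}) (Theta : set R) (V : R).
Hypothesis mT : is_expfam m Theta.
Hypothesis VT : forall rho, expfam_set m Theta rho -> ('V_rho[id] <= V%:E)%E.
Implicit Types (th : R).

(* [b], [mu] and [s] are abstract so that unification never unfolds integrals. *)
Variables (b mu s : R -> R).
Hypothesis bE : log_partition m = b.
Hypothesis muE : forall th, mean (expfam m th) = mu th.
Hypothesis sE : forall th, fine (\int[expfam m th]_x (x ^+ 2)%:E) = s th.

Lemma measurable_expfam_density th :
  measurable_fun setT (fun x : R => expR (x * th - b th)).
Proof.
apply: measurableT_comp; first exact: measurable_expR.
by apply: measurable_funB => //; apply: measurable_funM.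
Qed.

Lemma expfam_integral th (g : R -> \bar R) : Theta th -> measurable_fun setT g ->
  (\int[expfam m th]_x g x =
   \int[m]_x (g x * (expR (x * th - b th))%:E))%E.
Proof.
move=> Tth mg; apply: (@integral_density _ _ _ _ _ m _ id
  (fun x => expR (x * th - b th))) => //.
- exact: measurable_expfam_density.
- by move=> A mA; rewrite -bE; exact: (expfamE mT Tth mA).
Qed.

Lemma expfam_integrable th (g : R -> \bar R) : Theta th ->
  (expfam m th).-integrable setT g ->
  m.-integrable setT (fun x => g x * (expR (x * th - b th))%:E)%E.
Proof.
move=> Tth /integrableP[mg gi]; apply/integrableP; split.
  apply: emeasurable_funM => //; apply/measurable_EFinP.
  exact: measurable_expfam_density.
rewrite (expfam_integral Tth) in gi; last exact: measurableT_comp.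
rewrite (le_lt_trans _ gi)// le_eqVlt; apply/orP; left; apply/eqP.
by apply: eq_integral => x _; rewrite abseM [X in (_ * X)%E]gee0_abs// lee_fin expR_ge0.
Qed.

(** The variance is the integral of the squared deviation from [fine] of the expectation, so its
    bound makes sense before the expectation is known to be finite. Integrability of [x] and
    [x ^+ 2] follows by domination. *)
Let integrable_center th : Theta th ->
  (expfam m th).-integrable setT (fun x => ((x - mu th) ^+ 2)%:E).
Proof.
move=> Tth; apply/integrableP; split.
  by apply/measurable_EFinP; apply: measurable_funX; apply: measurable_funB.
have /VT : expfam_set m Theta (expfam m th) by exists th.
rewrite /variance covariance.unlock expectation.unlock => Vle.
rewrite (le_lt_trans _ (ltry V))// (le_trans _ Vle)// le_eqVlt.
apply/orP; left; apply/eqP; apply: eq_integral => x _.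
rewrite gee0_abs; last by rewrite lee_fin sqr_ge0.
by rewrite expr2 -muE /mean expectation.unlock.
Qed.

Let integrable_id th : Theta th -> (expfam m th).-integrable setT (EFin \o id).
Proof.
move=> Tth; apply: (le_integrable _ _ _ (integrableD _ (integrable_center Tth)
  (finite_measure_integrable_cst _ (1 + `|mu th|) measurableT))) => //.
  by apply/measurable_EFinP.
move=> x _ /=; rewrite lee_fin [leRHS]ger0_norm; last first.
  by rewrite addr_ge0 ?sqr_ge0// addr_ge0.
have -> : x = (x - mu th) + mu th by rewrite subrK.
rewrite (le_trans (ler_normD _ _))// addrK addrA lerD2r.
have := sqr_ge0 (`|x - mu th| - 1).
have := normr_ge0 (x - mu th).
rewrite -(real_normK (num_real (x - mu th))); nra.
Qed.

Let integrable_sqr th : Theta th ->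
  (expfam m th).-integrable setT (fun x => (x ^+ 2)%:E).
Proof.
move=> Tth; apply: (le_integrable _ _ _ (integrableD _
    (integrableZl _ 2 (integrable_center Tth))
  (finite_measure_integrable_cst _ (2 * mu th ^+ 2) measurableT))) => //.
  by apply/measurable_EFinP; exact: measurable_funX.
move=> x _ /=; rewrite lee_fin !ger0_norm.
- by have := sqr_ge0 (x - 2 * mu th); move: (mu th) => c; nra.
- by rewrite addr_ge0// mulr_ge0// sqr_ge0.
- exact: sqr_ge0.
Qed.

(** Moment inequalities are obtained below by integrating pointwise inequalities between quadratic
    polynomials; [quadE] reads off the integral from the coefficients and the first two moments. *)
Let quad (p : R * R * R) (x : R) := p.1.1 * x ^+ 2 + p.1.2 * x + p.2.
Let quadE (p : R * R * R) th := p.1.1 * s th + p.1.2 * mu th + p.2.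

Let integrable_quad p th : Theta th ->
  (expfam m th).-integrable setT (EFin \o quad p).
Proof.
move=> Tth.
have := integrableD measurableT (integrableD measurableT
  (integrableZl measurableT p.1.1 (integrable_sqr Tth))
  (integrableZl measurableT p.1.2 (integrable_id Tth)))
  (finite_measure_integrable_cst (expfam m th) p.2 measurableT).
by apply: eq_integrable => // x _.
Qed.

Let integral_quad p th : Theta th ->
  (\int[expfam m th]_x (quad p x)%:E = (quadE p th)%:E)%E.
Proof.
move=> Tth; have i1 := integrableZl measurableT p.1.1 (integrable_sqr Tth).
have i2 := integrableZl measurableT p.1.2 (integrable_id Tth).
transitivity (\int[expfam m th]_x
  ((p.1.1%:E * (x ^+ 2)%:E + p.1.2%:E * x%:E) + p.2%:E))%E; first by [].
rewrite integralD//; [|exact: integrableD|exact: finite_measure_integrable_cst].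
rewrite integralD// integralZl//; last exact: integrable_sqr.
rewrite integralZl//; last exact: integrable_id.
rewrite integral_cst//.
rewrite [X in (_ + _ * X)%E](_ : _ = 1%E); last exact: probability_setT.
rewrite mule1.
rewrite /quadE 2!EFinD !EFinM -sE fineK; last first.
  exact: integrable_fin_num (integrable_sqr Tth).
rewrite -muE /mean expectation.unlock fineK//.
exact: integrable_fin_num (integrable_id Tth).
Qed.

(* Both sides are integrals against [m] once the densities are made explicit. *)
Let quad_le p q th th' : Theta th -> Theta th' ->
  (forall x, quad p x <= quad q x * expR (x * (th' - th) - (b th' - b th))) ->
  quadE p th <= quadE q th'.
Proof.
move=> Tth Tth' pq.
have EI r t : Theta t -> ((quadE r t)%:E =
    \int[m]_x ((quad r x)%:E * (expR (x * t - b t))%:E))%E.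
  move=> Tt; rewrite -(integral_quad r Tt); apply: expfam_integral => //.
  exact: measurable_int (integrable_quad r Tt).
suff : (\int[m]_x ((quad p x)%:E * (expR (x * th - b th))%:E) <=
    \int[m]_x ((quad q x)%:E * (expR (x * th' - b th'))%:E))%E.
  move: (EI p th Tth) (EI q th' Tth') => e1 e2.
  by rewrite -[X in (X <= _)%E]e1 -[X in (_ <= X)%E]e2 lee_fin.
apply: (@le_integral _ _ _ m setT measurableT).
- exact: (expfam_integrable Tth (integrable_quad p Tth)).
- exact: (expfam_integrable Tth' (integrable_quad q Tth')).
move=> x _; rewrite -!EFinM lee_fin.
by rewrite (expR_tilt x th th' (b th) (b th')) mulrA ler_wpM2r ?expR_ge0.
Qed.

Let second_moment_le th : Theta th -> s th <= V + mu th ^+ 2.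
Proof.
move=> Tth; have /VT : expfam_set m Theta (expfam m th) by exists th.
rewrite /variance covariance.unlock expectation.unlock => Vle.
have sqrE (y c : R) : 1 * y ^+ 2 + - (2 * c) * y + c ^+ 2 = (y - c) * (y - c).
  by ring.
have : (\int[expfam m th]_x (quad (1, - (2 * mu th), mu th ^+ 2) x)%:E <= V%:E)%E.
  rewrite (le_trans _ Vle)// le_eqVlt; apply/orP; left; apply/eqP.
  apply: eq_integral => x _; congr EFin.
  transitivity ((x - mu th) * (x - mu th)); first exact: sqrE.
  by rewrite -muE /mean expectation.unlock.
by rewrite integral_quad// lee_fin /quadE/=; nra.
Qed.

(** Integrate [1 + u <= expR u] under [th], with [u] the log-likelihood ratio of [th'] against [th]:
    the right side becomes the total mass under [th']. *)
Lemma mean_subgradient th th' : Theta th -> Theta th' ->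
  (th' - th) * mu th <= b th' - b th.
Proof.
move=> Tth Tth'.
pose p : R * R * R := (0, th' - th, 1 - (b th' - b th)); pose q : R * R * R := (0, 0, 1).
have pq (x : R) : quad p x <= quad q x * expR (x * (th' - th) - (b th' - b th)).
  rewrite /quad /=; have := expR_ge1Dx (x * (th' - th) - (b th' - b th)).
  by set e := expR _; lra.
by have := @quad_le p q _ _ Tth Tth' pq; rewrite /quadE /=; lra.
Qed.

(** Applied to [u = (th' - th) * (x - c)], for which [expR u] is the ratio of the densities at [th']
    and [th]. *)
Let mul_expR_sub1_le (u : R) : u * (expR u - 1) <= u ^+ 2 * (expR u + 1).
Proof.
have e0 := expR_ge0 u; have [u0|u0] := leP 0 u.
- suff : expR u - 1 <= u * expR u by nra.
  have : (1 - u) * expR u <= expR (- u) * expR u.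
    by rewrite ler_wpM2r//; exact: expR_ge1Dx.
  by rewrite -expRD addNr expR0; lra.
- by have := expR_ge1Dx u; nra.
Qed.

(* [c] is the point where the two densities agree, so the integrand
   [(x - c) (f' x - f x)] is bounded by [(th' - th) (x - c)^2 (f' x + f x)]. *)
Lemma mean_lipschitz0 th th' : Theta th -> Theta th' -> th <= th' ->
  mu th' - mu th <= (th' - th) * (2 * V + (mu th' - mu th) ^+ 2).
Proof.
move=> Tth Tth'; rewrite le_eqVlt => /predU1P[->|h]; first by rewrite !subrr mul0r.
have h0 : 0 < th' - th by rewrite subr_gt0.
pose c := (b th' - b th) / (th' - th).
have cE : b th' - b th = c * (th' - th) by rewrite /c divfK// gt_eqF.
have c1 : mu th <= c.
  by have := mean_subgradient Tth Tth'; rewrite cE mulrC ler_pM2r.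
have c2 : c <= mu th'.
  have := mean_subgradient Tth' Tth.
  by move=> H; rewrite -(ler_pM2r h0) -cE; lra.
(* With [h = th' - th], these are [- h * (x - c) ^+ 2 - (x - c)] and [h * (x - c) ^+ 2 - (x - c)]:
   the terms of the pointwise bound, sorted by the density that multiplies them. *)
pose p : R * R * R := (- (th' - th), 2 * (th' - th) * c - 1, - (th' - th) * c ^+ 2 + c).
pose q : R * R * R := (th' - th, - (2 * (th' - th) * c) - 1, (th' - th) * c ^+ 2 + c).
have pq (x : R) : quad p x <= quad q x * expR (x * (th' - th) - (b th' - b th)).
  rewrite /quad /= cE -mulrBl [(x - c) * _]mulrC.
  have := mul_expR_sub1_le ((th' - th) * (x - c)).
  set e := expR _; rewrite -subr_ge0 => He; rewrite -(ler_pM2l h0) -subr_ge0.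
  by apply: le_trans He _; rewrite le_eqVlt; apply/orP; left; apply/eqP; ring.
have := @quad_le p q _ _ Tth Tth' pq; rewrite /quadE /=.
have := ler_wpM2l (ltW h0) (second_moment_le Tth).
have := ler_wpM2l (ltW h0) (second_moment_le Tth').
(* As [c] lies between the two means, the squares of its distances to them add up to at most the
   square of their difference. *)
have : 0 <= (th' - th) * ((c - mu th) * (mu th' - c)).
  by apply: mulr_ge0; [exact: ltW|apply: mulr_ge0; rewrite subr_ge0].
lra.
Qed.

Let measurable_expfam_ratio (th ph : R) : measurable_fun setT
  (fun x : R => (expR (x * (th - ph) - (b th - b ph)))%:E).
Proof.
apply/measurable_EFinP; apply: measurableT_comp; first exact: measurable_expR.
by apply: measurable_funB => //; apply: measurable_funM.
Qed.

Lemma expfam_change_of_density th ph (A : set R) : Theta th -> Theta ph ->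
  measurable A -> (expfam m th A =
  \int[expfam m ph]_(x in A) (expR (x * (th - ph) - (b th - b ph)))%:E)%E.
Proof.
move=> Tth Tph mA; rewrite integral_mkcond expfam_integral//; last first.
  apply/(measurable_restrictT _ _).1 => //; apply: measurable_funTS.
  exact: measurable_expfam_ratio.
rewrite (expfamE mT)// /tilt bE integral_mkcond; apply: eq_integral => x _.
rewrite !patchE; case: ifPn => _; last by rewrite mul0e.
by rewrite -EFinM -expR_tilt.
Qed.

Lemma expfam_dominates th ph : Theta th -> Theta ph ->
  expfam m th `<< expfam m ph.
Proof.
move=> Tth Tph; apply/null_content_dominatesP => A mA A0.
rewrite (expfam_change_of_density Tth Tph mA); apply: null_set_integral => //.
apply: measurable_funTS; exact: measurable_expfam_ratio.
Qed.

(** The Radon-Nikodym derivative has the same integrals as the explicit ratio of densities, hence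
    equals it almost everywhere for [ph], and by domination for [th]. Its logarithm is affine in
    [x], so only the mean enters. *)
Lemma KLdiv_expfam th ph : Theta th -> Theta ph ->
  KLdiv (expfam m th) (expfam m ph) = (bregman b mu th ph)%:E.
Proof.
move=> Tth Tph; have dom := expfam_dominates Tth Tph.
rewrite /KLdiv asboolT//.
set rn := Radon_Nikodym _ _.
have irn : (expfam m ph).-integrable setT rn by exact: Radon_Nikodym_integrable.
have mrn : measurable_fun setT rn by exact: measurable_int irn.
have rnE : ae_eq (expfam m ph) setT rn
    (fun x : R => (expR (x * (th - ph) - (b th - b ph)))%:E).
  apply: (integral_ae_eq measurableT irn (measurable_expfam_ratio th ph)).
  move=> E _ mE; transitivity (expfam m th E).
    by rewrite /rn -Radon_Nikodym_integral.
  exact: expfam_change_of_density.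
have {}rnE := null_dominates_ae_eq measurableT dom rnE.
have qE (x : R) :
    x * (th - ph) - (b th - b ph) = quad (0, th - ph, - (b th - b ph)) x.
  by rewrite /quad/=; ring.
transitivity (\int[expfam m th]_x (quad (0, th - ph, - (b th - b ph)) x)%:E)%E.
  apply: ae_eq_integral => //.
  (* The derivative is finite everywhere, so [lne] can be rewritten through the real [ln], whose
     measurability is known. *)
  - have -> : (fun x => lne (rn x)) = (fun x =>
        if fine (rn x) <= 0 then -oo%E else (ln (fine (rn x)))%:E).
      apply/funext => x; rewrite -{1}[rn x]fineK//.
      exact: Radon_Nikodym_fin_num.
    have mfrn : measurable_fun setT (fine \o rn) by exact: measurableT_comp.
    apply: measurable_fun_ifT => //; first exact: measurable_fun_ler.
    by apply/measurable_EFinP; apply: measurableT_comp mfrn; exact: measurable_ln.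
  - exact: measurable_int (integrable_quad _ Tth).
  - move: rnE; apply: filterS => x /(_ Logic.I) rnx _.
    by rewrite rnx lne_EFin ?expR_gt0// expRK qE.
by rewrite integral_quad// /quadE /bregman/=; congr EFin; ring.
Qed.

Lemma likelihood_ratio_integral th ph : Theta th -> Theta ph ->
  (\int[expfam m ph]_x (expR ((th - ph) * x - (b th - b ph)))%:E = 1)%E.
Proof.
move=> Tth Tph; under eq_integral do rewrite mulrC.
rewrite -(@expfam_change_of_density th ph setT)//; exact: probability_setT.
Qed.

(** The parameter selected inside [expfam_of_mean]; it is meaningful only when some member has mean
    [x]. *)
Definition param_of_mean (x : R) : R :=
  get [set th | Theta th /\ mean (expfam m th) = x].

Lemma param_of_meanP x : (exists2 rho, expfam_set m Theta rho & mean rho = x) ->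
  Theta (param_of_mean x) /\ mu (param_of_mean x) = x.
Proof.
move=> [_ [th Tth <-] thx]; rewrite -muE.
exact: (@getPex _ [set th | Theta th /\ mean (expfam m th) = x]
  (ex_intro _ th (conj Tth thx))).
Qed.

Lemma KL_bregman x y :
  Theta (param_of_mean x) -> Theta (param_of_mean y) ->
  KL m Theta x y = bregman b mu (param_of_mean x) (param_of_mean y).
Proof.
move=> Tx Ty; rewrite /KL /expfam_of_mean -/(param_of_mean x).
by rewrite -/(param_of_mean y) KLdiv_expfam.
Qed.

End exponential_family_moments.

(** * Rewards given the history *)

Section history.
Context {R : realType} {d : measure_display} {Omega : measurableType d}.
Context {P : probability Omega R} {K : nat}.
Context {I : nat -> Omega -> 'I_K} {r : nat -> Omega -> R}.
Context {nu : 'I_K -> probability R R} {T : nat}.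
Hypothesis PIr : bandit_interaction P I r nu T.

Definition history_gen t : set_system Omega :=
  [set A | exists2 s, (1 <= s < t)%N &
     (exists a, A = I s @^-1` [set a]) \/
     (exists2 B : set R, measurable B & A = r s @^-1` B)].

(** [Omega] with the history as its sigma-algebra: being determined by the history becomes ordinary
    measurability on this type. *)
Definition histType t : measurableType _ := g_sigma_algebraType (history_gen t).

Lemma history_measurable t (A : set Omega) : (t <= T.+1)%N ->
  history I r t A -> measurable A.
Proof.
move=> tT; apply: smallest_sub.
  split => //; first by move=> B mB; rewrite setTD; exact: measurableC.
  by move=> F mF; exact: bigcupT_measurable.
move=> B [s /andP[s1 st]]; have sT : (1 <= s <= T)%N.
  by rewrite s1 -ltnS (leq_trans st).
have [mI mr _] := PIr sT; case=> [[a ->]//|[C mC ->]].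
by rewrite -[X in measurable X]setTI; exact: mr.
Qed.

Lemma measurable_hist t {d'} {U : measurableType d'} (f : Omega -> U) :
  (t <= T.+1)%N -> measurable_fun (setT : set (histType t)) f ->
  measurable_fun (setT : set Omega) f.
Proof.
move=> tT mf _ B mB; apply: (history_measurable tT).
exact: mf.
Qed.

Lemma history_set t (f : Omega -> bool) :
  measurable_fun (setT : set (histType t)) f -> history I r t [set w | f w].
Proof.
move=> mf; have : measurable ((setT : set (histType t)) `&` f @^-1` [set true]).
  exact: mf.
by rewrite setTI.
Qed.

Lemma measurable_hist_I t s a : (1 <= s < t)%N ->
  measurable_fun (setT : set (histType t)) (fun w => I s w == a).
Proof.
move=> st; apply: (measurable_fun_bool true); rewrite setTI.
apply: sub_sigma_algebra; exists s => //; left; exists a.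
by apply/seteqP; split => w /= /eqP.
Qed.

Lemma measurable_hist_r t s : (1 <= s < t)%N ->
  measurable_fun (setT : set (histType t)) (r s).
Proof.
move=> st _ B mB; rewrite setTI.
by apply: sub_sigma_algebra; exists s => //; right; exists B.
Qed.

Lemma measurable_hist_pulls t n a : (n < t)%N ->
  measurable_fun (setT : set (histType t)) (pulls I n a).
Proof.
elim: n => [|n IH] nt.
  have -> : pulls I 0 a = cst 0%N by apply/funext => w; rewrite /pulls big_geq.
  exact: measurable_cst.
have -> : pulls I n.+1 a = (fun w => pulls I n a w + (I n.+1 w == a))%N.
  by apply/funext => w; rewrite /pulls big_nat_recr//=.
apply: measurable_fun_addn; first by apply: IH; exact: ltnW.
have mb : measurable_fun setT nat_of_bool by move=> _ B _.
by apply: (measurableT_comp mb); exact: measurable_hist_I.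
Qed.

Definition reward_sum n a (w : Omega) : R :=
  \sum_(1 <= s < n.+1 | I s w == a) r s w.

Lemma measurable_hist_reward_sum t n a : (n < t)%N ->
  measurable_fun (setT : set (histType t)) (reward_sum n a).
Proof.
elim: n => [|n IH] nt.
  have -> : reward_sum 0 a = cst 0.
    by apply/funext => w; rewrite /reward_sum big_geq.
  exact: measurable_cst.
have -> : reward_sum n.+1 a = (fun w => reward_sum n a w +
    if I n.+1 w == a then r n.+1 w else 0).
  by apply/funext => w; rewrite /reward_sum big_mkcond big_nat_recr//= -big_mkcond.
apply: measurable_funD; first by apply: IH; exact: ltnW.
apply: measurable_fun_ifT => //; first exact: measurable_hist_I.
exact: measurable_hist_r.
Qed.

Lemma measurable_hist_emp_mean t n a : (n < t)%N ->
  measurable_fun (setT : set (histType t)) (emp_mean I r n a).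
Proof.
move=> nt; apply: measurable_funM; first exact: measurable_hist_reward_sum.
have mi : measurable_fun setT (fun k : nat => (k%:R : R)^-1) by move=> _ B _.
apply: (measurableT_comp mi).
exact: measurable_hist_pulls.
Qed.

(** Both sides are the integral of [Y] against one measure on the history, the restriction of [P] to
    [I t = a]. It has the density [\1_A] and, by the conditional law of the reward and the
    normalization of [h], also the density [\1_A * h (r t)]. *)
Lemma history_reward_integral t a (Y : Omega -> \bar R) (h : R -> R) :
  (1 <= t <= T)%N -> (forall w, 0 <= Y w)%E ->
  measurable_fun (setT : set (histType t)) Y ->
  (forall x, 0 <= h x) -> measurable_fun setT h ->
  (\int[nu a]_x (h x)%:E = 1)%E ->
  (\int[P]_w (Y w * ((I t w == a)%:R * h (r t w))%:E) =
   \int[P]_w (Y w * ((I t w == a)%:R)%:E))%E.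
Proof.
move=> tT Y0 mY h0 mh h1; have [mI mr hr] := PIr tT.
have tT1 : (t <= T.+1)%N by case/andP: tT => _ /leqW.
pose A := I t @^-1` [set a]; have mA : measurable A by exact: mI.
have AE w : ((I t w == a)%:R : R) = \1_A w.
  by rewrite indicE; congr (nat_of_bool _)%:R; apply/idP/idP; rewrite inE => /eqP.
pose idh : Omega -> histType t := id.
have midh : measurable_fun setT idh.
  by move=> _ B mB; rewrite setTI; exact: (history_measurable tT1 mB).
pose Q := pushforward (mrestr P mA) idh.
transitivity (\int[Q]_w Y w)%E; last first.
  under [RHS]eq_integral do rewrite AE.
  apply: (@ge0_integral_density _ _ _ _ _ P _ idh (\1_A)) => //.
  move=> E mE; rewrite integral_indic//; last exact: (history_measurable tT1 mE).
  by rewrite setIC.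
apply/esym; under [RHS]eq_integral do rewrite AE.
have mhr : measurable_fun setT (fun w => h (r t w)) by exact: measurableT_comp.
apply: (@ge0_integral_density _ _ _ _ _ P _ idh (fun w => \1_A w * h (r t w))) => //.
- exact: measurable_funM.
- by move=> w; rewrite mulr_ge0.
move=> E hE; have mE : @measurable d Omega E by exact: (history_measurable tT1 hE).
have mEA : @measurable d Omega (E `&` A) by exact: measurableI.
have PEA0 : (0 <= fine (P (E `&` A)))%R by rewrite fine_ge0.
have PEA : ((fine (P (E `&` A)))%:E = P (E `&` A))%E.
  by rewrite fineK// fin_num_measure.
(* The law of [r t] on the event [E] intersected with [A], by the interaction hypothesis. *)
pose nu' := mscale (NngNum PEA0) (nu a).
have nu'E : (\int[nu']_x (h x)%:E =
    \int[P]_w ((h (r t w))%:E * (\1_(E `&` A) w)%:E))%E.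
  apply: (@ge0_integral_density _ _ _ _ _ P nu' (r t)
    (\1_(E `&` A)) _ _ _ _ (EFin \o h)) => //.
  - move=> B mB; rewrite integral_indic//; last first.
      by rewrite -[X in measurable X]setTI; exact: mr.
    rewrite [X in _ = P X](_ : _ = E `&` A `&` r t @^-1` B); last by rewrite setIC.
    by rewrite hr// -[in RHS]PEA.
  - exact/measurable_EFinP.
transitivity (\int[nu']_x (h x)%:E)%E.
  rewrite ge0_integral_mscale//; last 2 first.
  - exact/measurable_EFinP.
  - by move=> x _; rewrite lee_fin.
  by rewrite h1 mule1 PEA.
rewrite nu'E integral_mkcond [RHS]integral_mkcond.
apply: eq_integral => w _; rewrite !patchE in_setT -EFinM indicE in_setI.
case: (w \in E) => /=; rewrite ?mulr0//.
by rewrite indicE mulrC.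
Qed.
End history.

(** The sum is the expected number of events that occur, and [g] dominates that number pointwise. *)
Lemma sum_probability_le {R : realType} {d} {Omega : measurableType d}
    (P : probability Omega R) (n : nat) (E : nat -> set Omega) (g : Omega -> R) :
  (forall t, (1 <= t < n.+1)%N -> measurable (E t)) -> measurable_fun setT g ->
  (forall w, \sum_(1 <= t < n.+1) \1_(E t) w <= g w) ->
  (\sum_(1 <= t < n.+1) P (E t) <= \int[P]_w (g w)%:E)%E.
Proof.
move=> mE mg Eg.
(* Measurability is assumed only for indices in the range, so the events are emptied outside it
   before exchanging sum and integral. *)
pose F t := if (1 <= t < n.+1)%N then E t else set0.
have mF t : measurable (F t) by rewrite /F; case: ifPn => // /mE.
have -> : (\sum_(1 <= t < n.+1) P (E t) = \sum_(1 <= t < n.+1) P (F t))%E.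
  by apply: eq_big_nat => t tn; rewrite /F tn.
have -> : (\sum_(1 <= t < n.+1) P (F t) =
    \int[P]_w \sum_(1 <= t < n.+1) (\1_(F t) w)%:E)%E.
  rewrite ge0_integral_sum//.
  - by apply: eq_bigr => t _; rewrite integral_indic// setIT.
  - by move=> t; apply/measurable_EFinP.
have FE w : (\sum_(1 <= t < n.+1) (\1_(F t) w)%:E =
    (\sum_(1 <= t < n.+1) \1_(E t) w)%:E :> \bar R)%E.
  by rewrite sumEFin; congr EFin; apply: eq_big_nat => t tn; rewrite /F tn.
apply: ge0_le_integral => //.
- by move=> w _; rewrite FE lee_fin sumr_ge0.
- by apply: emeasurable_sum => t; exact/measurable_EFinP.
- exact/measurable_EFinP.
- by move=> w _; rewrite FE lee_fin.
Qed.

(** * Likelihood ratios along the pulls of one arm *)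

Section likelihood_ratio.
Context {R : realType} {d : measure_display} {Omega : measurableType d}.
Context {P : probability Omega R} {K : nat}.
Context {I : nat -> Omega -> 'I_K} {r : nat -> Omega -> R}.
Context {nu : 'I_K -> probability R R} {T : nat}.
Hypothesis PIr : bandit_interaction P I r nu T.
Variable a : 'I_K.

Local Notation histType := (@histType R d Omega K I r).

Lemma pullsS n w : pulls I n.+1 a w = (pulls I n a w + (I n.+1 w == a))%N.
Proof. by rewrite /pulls big_nat_recr//=. Qed.

Lemma pulls0 w : pulls I 0 a w = 0%N.
Proof. by rewrite /pulls big_geq. Qed.

Lemma leq_pulls n n' w : (n <= n')%N -> (pulls I n a w <= pulls I n' a w)%N.
Proof.
elim: n' => [|n' IH]; first by rewrite leqn0 => /eqP ->.
rewrite leq_eqVlt => /predU1P[->//|]; rewrite ltnS => /IH h.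
by rewrite pullsS (leq_trans h)// leq_addr.
Qed.

Lemma leq_pulls_id n w : (pulls I n a w <= n)%N.
Proof.
elim: n => [|n IH]; first by rewrite pulls0.
by rewrite pullsS -addn1 leq_add// leq_b1.
Qed.

(** At most one round pulls [a] after exactly [k] earlier pulls; this removes the sum over rounds in
    [lr_event_pull_probability]. *)
Lemma sum_pull_at_count k n w :
  (\sum_(1 <= t < n.+1) ((I t w == a) && (pulls I t.-1 a w == k)) =
   (k < pulls I n a w))%N.
Proof.
elim: n => [|n IH]; first by rewrite big_geq// pulls0.
rewrite big_nat_recr//= IH pullsS; case: (I n.+1 w == a); last by rewrite !addn0.
by rewrite addn1 ltnS /= [in RHS]leq_eqVlt [k == _]eq_sym; case: ltngtP.
Qed.

Lemma sum_pull_before_count u n w :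
  (\sum_(1 <= t < n.+1) ((I t w == a) && (pulls I t.-1 a w < u)) =
   minn u (pulls I n a w))%N.
Proof.
elim: n => [|n IH]; first by rewrite big_geq// pulls0 minn0.
rewrite big_nat_recr//= IH pullsS; case: (I n.+1 w == a); last by rewrite !addn0.
by case: (ltnP (pulls I n a w) u) => h /=; lia.
Qed.

Section stopped_product.
Variables (k : nat) (h : R -> R).
Hypothesis h0 : forall x, 0 <= h x.
Hypothesis mh : measurable_fun setT h.

(* A stopped martingale when [h] is a likelihood ratio: only the first [k]
   pulls of arm [a] contribute. *)
Definition stopped_product n w : R := \prod_(1 <= s < n.+1)
  if (I s w == a) && (pulls I s.-1 a w < k)%N then h (r s w) else 1.

Lemma stopped_productS n w : stopped_product n.+1 w = stopped_product n w *
  if (I n.+1 w == a) && (pulls I n a w < k)%N then h (r n.+1 w) else 1.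
Proof. by rewrite /stopped_product big_nat_recr//=. Qed.

Lemma stopped_product_ge0 n w : 0 <= stopped_product n w.
Proof. by apply: prodr_ge0 => s _; case: ifPn. Qed.

Lemma measurable_hist_stopped_product t n : (n < t)%N ->
  measurable_fun (setT : set (histType t)) (stopped_product n).
Proof.
elim: n => [|n IH] nt.
  have -> : stopped_product 0 = cst 1.
    by apply/funext => w; rewrite /stopped_product big_geq.
  exact: measurable_cst.
rewrite (funext (stopped_productS n)).
apply: measurable_funM; first by apply: IH; exact: ltnW.
apply: measurable_fun_ifT => //; last first.
  by apply: (measurableT_comp mh); exact: measurable_hist_r.
apply: measurable_and; first exact: measurable_hist_I.
by apply: measurable_fun_ltn => //; apply: measurable_hist_pulls; exact: ltnW.
Qed.

Hypothesis h1 : (\int[nu a]_x (h x)%:E = 1)%E.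

Lemma stopped_product_integral n : (n <= T)%N ->
  (\int[P]_w (stopped_product n w)%:E = 1)%E.
Proof.
elim: n => [|n IH] nT.
  under eq_integral do rewrite /stopped_product big_geq//.
  by rewrite integral_cst// mul1e; exact: probability_setT.
(* On [I n.+1 = a], [Y] is the part that the next reward multiplies; [Z] is the part left unchanged.
   Replacing the new factor by 1 in the former gives back the product at [n]. *)
pose Y w := stopped_product n w * (pulls I n a w < k)%N%:R.
pose Z w := stopped_product n w * (1 - (I n.+1 w == a)%:R * (pulls I n a w < k)%N%:R).
have Y0 w : (0 <= (Y w)%:E)%E by rewrite lee_fin mulr_ge0 ?stopped_product_ge0.
have Z0 w : (0 <= (Z w)%:E)%E.
  rewrite lee_fin mulr_ge0 ?stopped_product_ge0// subr_ge0.
  by case: (_ == _); case: (_ < _)%N; rewrite ?mulr0 ?mul0r ?mul1r.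
have mb : measurable_fun setT (fun x : bool => x%:R : R) by move=> _ B _.
have mYt t : (n < t)%N -> measurable_fun (setT : set (histType t)) Y.
  move=> nt; apply: measurable_funM; first exact: measurable_hist_stopped_product.
  apply: (measurableT_comp mb).
  by apply: measurable_fun_ltn => //; exact: measurable_hist_pulls.
have mIt t : (n.+1 < t)%N ->
    measurable_fun (setT : set (histType t)) (fun w => (I n.+1 w == a)%:R : R).
  by move=> nt; apply: (measurableT_comp mb); exact: measurable_hist_I.
have lift (f : Omega -> R) :
    measurable_fun (setT : set (histType n.+2)) f ->
    measurable_fun setT (EFin \o f).
  by move=> mf; apply/measurable_EFinP; exact: (measurable_hist PIr _ mf).
have mZ : measurable_fun setT (EFin \o Z).
  apply: lift; apply: measurable_funM; first exact: measurable_hist_stopped_product.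
  apply: measurable_funB => //; apply: measurable_funM; first exact: mIt.
  apply: (measurableT_comp mb).
  by apply: measurable_fun_ltn => //; exact: measurable_hist_pulls.
have mYI : measurable_fun setT (fun w => ((Y w)%:E * ((I n.+1 w == a)%:R)%:E)%E).
  apply: emeasurable_funM; apply: lift; [exact: mYt|exact: mIt].
have mYIh : measurable_fun setT
    (fun w => ((Y w)%:E * ((I n.+1 w == a)%:R * h (r n.+1 w))%:E)%E).
  apply: emeasurable_funM; apply: lift; first exact: mYt.
  apply: measurable_funM; first exact: mIt.
  by apply: (measurableT_comp mh); apply: measurable_hist_r => /=.
have E1 w : (stopped_product n.+1 w)%:E =
    ((Y w)%:E * ((I n.+1 w == a)%:R * h (r n.+1 w))%:E + (Z w)%:E)%E.
  rewrite -EFinM -EFinD stopped_productS /Y /Z; congr EFin.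
  by case: (_ == _) => /=; case: (_ < _)%N => /=; ring.
have E2 w : (stopped_product n w)%:E =
    ((Y w)%:E * ((I n.+1 w == a)%:R)%:E + (Z w)%:E)%E.
  by rewrite -EFinM -EFinD /Y /Z; congr EFin; ring.
under eq_integral do rewrite E1.
rewrite ge0_integralD//; last first.
  by move=> w _; apply: mule_ge0; rewrite // lee_fin; apply: mulr_ge0; rewrite ?ler0n.
rewrite (history_reward_integral PIr)//; last first.
  by apply/measurable_EFinP; exact: mYt.
rewrite -ge0_integralD//.
- by under eq_integral do rewrite -E2; exact: IH (ltnW nT).
- by move=> w _; apply: mule_ge0; rewrite // lee_fin ler0n.
Qed.

(** Stopping freezes the product after [k] pulls, so an event observed at an earlier round is still
    controlled by the product at the horizon. *)
Lemma stopped_product_eq n n' w : (n <= n')%N -> pulls I n a w = k ->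
  stopped_product n' w = stopped_product n w.
Proof.
move=> + nk; elim: n' => [|n' IH]; first by rewrite leqn0 => /eqP ->.
rewrite leq_eqVlt => /predU1P[->//|]; rewrite ltnS => nn'.
by rewrite stopped_productS IH// -nk ltnNge leq_pulls//= andbF mulr1.
Qed.

End stopped_product.

Variables la c : R.
Hypothesis lac : (\int[nu a]_x (expR (la * x - c))%:E = 1)%E.
Implicit Types (k : nat) (D : R).

Let h x := expR (la * x - c).

Let h0 x : 0 <= h x. Proof. exact: expR_ge0. Qed.

Let mh : measurable_fun setT h.
Proof.
apply: measurableT_comp; first exact: measurable_expR.
by apply: measurable_funB => //; apply: measurable_funM.
Qed.

Let stopped_productE k n w : (pulls I n a w <= k)%N -> stopped_product k h n w =
  expR (la * reward_sum (I := I) (r := r) n a w - c * (pulls I n a w)%:R).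
Proof.
elim: n => [|n IH].
  rewrite /stopped_product /reward_sum pulls0 !big_geq// => _.
  by rewrite !mulr0 subrr expR0.
rewrite pullsS stopped_productS.
have -> : reward_sum (I := I) (r := r) n.+1 a w =
    reward_sum (I := I) (r := r) n a w + if I n.+1 w == a then r n.+1 w else 0.
  by rewrite /reward_sum big_mkcond big_nat_recr//= -big_mkcond.
case: (I n.+1 w == a) => /=; last by rewrite addn0 !addr0 mulr1.
rewrite addn1 => nk; rewrite nk IH; last exact: ltnW.
by rewrite /h -expRD; congr expR; rewrite -natr1; ring.
Qed.

(** For [la = ps - th] and [c = b ps - b th], the compared quantity is the log-likelihood ratio of
    [ps] against [th] over the [k] rewards of arm [a]. *)
Definition lr_event k D n : set Omega := [set w | (pulls I n a w == k) &&
  (D <= la * reward_sum (I := I) (r := r) n a w - c * k%:R)].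

Lemma lr_event_measurable t k D n : (n < t)%N ->
  history I r t (lr_event k D n).
Proof.
move=> nt; apply: history_set; apply: measurable_and.
  by apply: measurable_fun_eqn => //; exact: measurable_hist_pulls.
apply: measurable_fun_ler => //; apply: measurable_funB => //.
by apply: measurable_funM => //; exact: measurable_hist_reward_sum.
Qed.

Let lr_event_le k D n n' w : (n <= n')%N -> lr_event k D n w ->
  1 <= expR (- D) * stopped_product k h n' w.
Proof.
move=> nn' /andP[/eqP nk Dle]; rewrite (stopped_product_eq _ nn' nk).
rewrite stopped_productE ?nk// -expRD -[leLHS]expR0 ler_expR; lra.
Qed.

Let mW k D n : (n <= T)%N ->
  measurable_fun setT (fun w => expR (- D) * stopped_product k h n w).
Proof.
move=> nT; apply: measurable_funM => //.
by apply: (measurable_hist PIr (t := n.+1)) => //; exact: measurable_hist_stopped_product.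
Qed.

Let integral_W k D n : (n <= T)%N ->
  (\int[P]_w (expR (- D) * stopped_product k h n w)%:E = (expR (- D))%:E)%E.
Proof.
move=> nT; under eq_integral do rewrite EFinM.
rewrite ge0_integralZl//.
- by rewrite (stopped_product_integral k h0 mh lac nT) mule1.
- apply/measurable_EFinP; apply: (measurable_hist PIr (t := n.+1)) => //.
  exact: measurable_hist_stopped_product.
- by move=> w _; rewrite lee_fin stopped_product_ge0.
Qed.

(** Markov's inequality for the stopped product, written as the one-event case of
    [sum_probability_le]. *)
Lemma lr_event_probability k D n : (n <= T)%N ->
  (P (lr_event k D n) <= (expR (- D))%:E)%E.
Proof.
move=> nT; rewrite -(integral_W k D nT).
have := @sum_probability_le _ _ _ P 1 (fun=> lr_event k D n) _ _ (mW k D nT).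
rewrite big_nat1; apply.
  move=> t _; apply: (history_measurable PIr (t := n.+1)) => //.
  exact: lr_event_measurable.
move=> w; rewrite big_nat1 indicE; case: (boolP (w \in _)) => [|_].
  by rewrite inE => /(lr_event_le (leqnn n)).
by rewrite mulr_ge0 ?expR_ge0 ?stopped_product_ge0.
Qed.

(** The bound carries no factor for the number of rounds: at most one round contributes for each
    outcome, and the product at [n] dominates it whichever round it is. *)
Lemma lr_event_pull_probability k D n : (n <= T)%N ->
  (\sum_(1 <= t < n.+1) P ([set w | I t w == a] `&` lr_event k D t.-1)
    <= (expR (- D))%:E)%E.
Proof.
move=> nT; rewrite -(integral_W k D nT); apply: sum_probability_le (mW k D nT) _.
  move=> t /andP[t1 tn]; apply: measurableI.
    apply: (history_measurable PIr (t := n.+1)) => //; apply: history_set.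
    by apply: measurable_hist_I; rewrite t1.
  apply: (history_measurable PIr (t := n.+1)) => //.
  by apply: lr_event_measurable; exact: leq_ltn_trans (leq_pred _) tn.
move=> w; set g := (leRHS).
have g0 : 0 <= g by rewrite mulr_ge0 ?expR_ge0 ?stopped_product_ge0.
have [[t [/andP[t1 tn] Et]]|noE] := pselect (exists t, (1 <= t < n.+1)%N /\
    ([set w | I t w == a] `&` lr_event k D t.-1) w); last first.
  rewrite big_nat big1// => t tn; rewrite indicE memNset// => Et.
  by apply: noE; exists t.
have : 1 <= g by apply: lr_event_le Et.2; rewrite -ltnS (leq_trans _ tn)// ltnS leq_pred.
apply: le_trans.
apply: (@le_trans _ _
  (\sum_(1 <= t < n.+1) ((I t w == a) && (pulls I t.-1 a w == k)) : nat)%:R).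
  rewrite natr_sum; apply: ler_sum => s _; rewrite indicE.
  case: (boolP (w \in _)) => [|_]; last by rewrite ler0n.
  by rewrite inE => -[/= -> /andP[->]].
by rewrite sum_pull_at_count lern1 leq_b1.
Qed.

End likelihood_ratio.

(** * From pointwise bounds on the policy to probabilities of pulls *)

Section nonmeasurable_comparison.
Context {R : realType} {d : measure_display} {Omega : measurableType d}.
Variable P : {measure set Omega -> \bar R}.

Import HBNNSimple.

(* [f] and [g] need not be measurable: the inequality is checked on the simple
   functions below [f] in the definition of the integral. *)
Lemma ae_le_integral_scale (E : set Omega) (f g : Omega -> R) (c : R) :
  measurable E -> 0 < c -> (forall w, 0 <= f w) -> (forall w, 0 <= g w) ->
  {ae P, forall w, E w -> f w <= c * g w} ->
  (\int[P]_(w in E) (f w)%:E <= c%:E * \int[P]_(w in E) (g w)%:E)%E.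
Proof.
move=> mE c0 f0 g0 [N [mN PN0 fgN]].
rewrite [leLHS]ge0_integralE; last by move=> w _; rewrite lee_fin.
apply: ge_ereal_sup => _ [h /= hf <-].
have mNC : measurable (~` N) by exact: measurableC.
have ci0 : 0 <= c^-1 by rewrite invr_ge0 ltW.
(* [h'] is [h] divided by [c] and set to 0 on the null set [N]; it is a simple function below [g] on
   [E], and [c] times its integral is that of [h]. *)
pose h' := scale_nnsfun (proj_nnsfun h mNC) ci0.
have h'E w : h' w = c^-1 * (h w * \1_(~` N) w) by [].
have hN w : ~ N w -> h w = c * h' w.
  by move=> Nw; rewrite h'E indicE mem_set// mulr1 mulVKf// gt_eqF.
have mh : measurable_fun setT (EFin \o h).
  by apply/measurable_EFinP; exact: measurable_funP.
have mh' : measurable_fun setT (EFin \o h').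
  by apply/measurable_EFinP; exact: measurable_funP.
have -> : (sintegral P h = c%:E * sintegral P h')%E.
  rewrite -!integralT_nnsfun -ge0_integralZl//; last 2 first.
  - by move=> w _; rewrite lee_fin.
  - by rewrite lee_fin ltW.
  apply: ge0_ae_eq_integral => //.
  - exact: measurable_funeM.
  - by move=> w _; rewrite lee_fin.
  - by move=> w _; rewrite mule_ge0// lee_fin// ltW.
  exists N; split => // w /= /not_implyP[_ hw]; apply: contrapT => Nw.
  by apply: hw; rewrite -EFinM; congr EFin; exact: hN.
rewrite lee_wpmul2l ?lee_fin ?(ltW c0)// -integralT_nnsfun.
rewrite [leRHS]ge0_integralE; last by move=> w _; rewrite lee_fin.
rewrite integralT_nnsfun; apply: ereal_sup_ubound; exists h' => //.
move=> w; have := hf w; rewrite /patch; case: ifPn => wE.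
- have [Nw|Nw] := pselect (N w).
    by move=> _; rewrite h'E indicE memNset => [|/(_ Nw)//]; rewrite !mulr0 lee_fin.
  rewrite hN// !lee_fin => hfw; rewrite -(ler_pM2l c0); apply: (le_trans hfw).
  apply: contrapT => nfg; apply: Nw; apply: fgN => /= H.
  by apply: nfg; exact: H (set_mem wE).
- rewrite h'E lee_fin => hw; rewrite lee_fin.
  have -> : h w = 0 by apply/eqP; rewrite eq_le hw/=.
  by rewrite mul0r mulr0.
Qed.

End nonmeasurable_comparison.

Section policy.
Context {R : realType} {d : measure_display} {Omega : measurableType d}.
Context {P : probability Omega R} {K : nat}.
Context {I : nat -> Omega -> 'I_K} {r : nat -> Omega -> R}.
Context {nu : 'I_K -> probability R R} {T : nat}.
Hypothesis PIr : bandit_interaction P I r nu T.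
Variable p : nat -> 'I_K -> Omega -> R.
Hypothesis p0 : forall t a w, 0 <= p t a w.
Hypothesis Pp : follows_policy P I r p T.
Implicit Types (t : nat) (a : 'I_K) (E : set Omega) (c : R).

(** Along with [policy_le], the way in which estimates on the policy after the initial rounds are
    used: an almost sure bound on an event of the history passes to the probabilities of the
    pulls. *)
Lemma policy_le_scale t E a a' c : (1 <= t <= T)%N -> history I r t E -> 0 < c ->
  {ae P, forall w, E w -> p t a w <= c * p t a' w} ->
  (P (E `&` [set w | I t w == a]) <=
   c%:E * P (E `&` [set w | I t w == a']))%E.
Proof.
move=> tT hE c0 pE.
have IE b : [set w | I t w == b] = I t @^-1` [set b].
  by apply/seteqP; split => w /= /eqP.
rewrite !IE !Pp//; apply: ae_le_integral_scale => //.
by apply: (history_measurable PIr _ hE); case/andP: tT => _ /leqW.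
Qed.

Lemma policy_le t E a c : (1 <= t <= T)%N -> history I r t E -> 0 < c ->
  {ae P, forall w, E w -> p t a w <= c} ->
  (P (E `&` [set w | I t w == a]) <= c%:E)%E.
Proof.
move=> tT hE c0 pE.
have mE : measurable E.
  by apply: (history_measurable PIr _ hE); case/andP: tT => _ /leqW.
have -> : [set w | I t w == a] = I t @^-1` [set a].
  by apply/seteqP; split => w /= /eqP.
rewrite Pp//; apply: (@le_trans _ _ (c%:E * \int[P]_(w in E) (1 : R)%:E)%E).
  apply: ae_le_integral_scale => //.
  by apply: filterS pE => w h /h; rewrite mulr1.
rewrite integral_cst// mul1e -[leRHS]mule1 lee_wpmul2l ?lee_fin ?(ltW c0)//.
exact: probability_le1.
Qed.

End policy.

Lemma probability_le_cover {R : realType} {d} {Omega : measurableType d}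
    (P : probability Omega R) (A : set Omega) (B : nat -> set Omega) (m n : nat) :
  measurable A -> (forall i, (m <= i < n)%N -> measurable (B i)) ->
  {ae P, forall w, A w -> exists2 i, (m <= i < n)%N & B i w} ->
  (P A <= \sum_(m <= i < n) P (B i))%E.
Proof.
move=> mA mB [N [mN PN0 AN]].
pose F i := if (m <= i < n)%N then B i else set0.
have mF i : measurable (F i) by rewrite /F; case: ifPn => // /mB.
have -> : (\sum_(m <= i < n) P (B i) = \sum_(m <= i < n) P (F i))%E.
  by apply: eq_big_nat => i mn; rewrite /F mn.
have -> : (\sum_(m <= i < n) P (F i) =
    \int[P]_w \sum_(m <= i < n) (\1_(F i) w)%:E)%E.
  rewrite ge0_integral_sum//; last by move=> i; apply/measurable_EFinP.
  by apply: eq_bigr => i _; rewrite integral_indic// setIT.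
have -> : P A = (\int[P]_w (\1_A w)%:E)%E by rewrite integral_indic// setIT.
apply: ae_ge0_le_integral => //.
- exact/measurable_EFinP.
- by move=> w _; rewrite sumEFin lee_fin sumr_ge0.
- by apply: emeasurable_sum => i; exact/measurable_EFinP.
exists N; split => // w /= /not_implyP[_ Aw]; apply: AN => /= H; apply: Aw.
rewrite sumEFin lee_fin [leLHS]indicE; case: (boolP (w \in A)) => [|_]; last first.
  by rewrite sumr_ge0.
rewrite inE => /H[i mn Bi]; rewrite (bigD1_seq i)/= ?mem_index_iota ?iota_uniq//.
by rewrite indicE /F mn mem_set// lerDl sumr_ge0.
Qed.

(** The partial sum is at most [expR (- q) / (1 - expR (- q))], and [1 + q <= expR q] bounds this by
    the inverse of [q]. *)
Lemma sum_expR_geometric_le {R : realType} (q : R) n : 0 < q ->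
  \sum_(1 <= k < n.+1) expR (- (k%:R * q)) <= q^-1.
Proof.
move=> q0; have e0 : 0 < expR (- q) by exact: expR_gt0.
have e1 : expR (- q) < 1 by rewrite -[ltRHS]expR0 ltr_expR oppr_lt0.
suff : (1 - expR (- q)) * \sum_(1 <= k < n.+1) expR (- (k%:R * q)) =
    expR (- q) - expR (- (n.+1%:R * q)).
  move=> H.
  have D0 : 0 < 1 - expR (- q) by rewrite subr_gt0.
  rewrite -(ler_pM2l D0) H.
  rewrite (@le_trans _ _ (expR (- q)))//; first by rewrite lerBlDr lerDl expR_ge0.
  rewrite ler_pdivlMr//.
  have : (1 + q) * expR (- q) <= expR q * expR (- q).
    by rewrite ler_wpM2r ?expR_ge1Dx// ltW.
  by rewrite -expRD subrr expR0; lra.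
elim: n => [|n IH]; first by rewrite big_geq// mulr0 mul1r subrr.
rewrite big_nat_recr//= mulrDr IH.
have -> : expR (- (n.+2%:R * q)) = expR (- (n.+1%:R * q)) * expR (- q).
  by rewrite -expRD -[n.+2%:R]natr1; congr expR; ring.
ring.
Qed.

Lemma historyT {R : realType} {d} {Omega : measurableType d} {K : nat}
    (I : nat -> Omega -> 'I_K) (r : nat -> Omega -> R) t : history I r t setT.
Proof.
have mT : measurable (setT : set (@histType R d Omega K I r t)) by exact: measurableT.
exact: mT.
Qed.

(** * One round of Exp-KL-MS *)

Section exp_kl_ms_round.
Context {R : realType} {m : {measure set R -> \bar R}} {Theta : set R} {K T : nat}.
Context {nu : 'I_K -> probability R R}.
Context {d : measure_display} {Omega : measurableType d} {P : probability Omega R}.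
Context {I : nat -> Omega -> 'I_K} {r : nat -> Omega -> R}.
Variables (V : R) (b mu par : R -> R) (theta : 'I_K -> R).
Hypothesis PIr : bandit_interaction P I r nu T.
Hypothesis Pp : follows_policy P I r (exp_kl_ms I r m Theta) T.
Hypothesis Theta_itv : forall x y z, Theta x -> Theta y -> x <= z <= y -> Theta z.
Hypothesis mu_subgradient : forall th th', Theta th -> Theta th' ->
  (th' - th) * mu th <= b th' - b th.
Hypothesis mu_lipschitz0 : forall th th', Theta th -> Theta th' -> th <= th' ->
  mu th' - mu th <= (th' - th) * (2 * V + (mu th' - mu th) ^+ 2).
Hypothesis V0 : 0 < V.
Hypothesis KLE : forall x y, Theta (par x) -> Theta (par y) ->
  KL m Theta x y = bregman b mu (par x) (par y).
Hypothesis theta_in : forall c, Theta (theta c).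
Hypothesis likelihood_ratio1 : forall c ps, Theta ps ->
  (\int[nu c]_x (expR ((ps - theta c) * x - (b ps - b (theta c))))%:E = 1)%E.
Hypothesis emp_in : forall t c, (1 <= t <= T)%N ->
  {ae P, forall w, (0 < pulls I t c w)%N ->
    Theta (par (emp_mean I r t c w)) /\
    mu (par (emp_mean I r t c w)) = emp_mean I r t c w}.
Implicit Types (n t k : nat) (c : 'I_K) (w : Omega).

Local Notation kl := (bregman b mu).
Local Notation hat := (emp_mean I r).
Local Notation hatmax := (emp_max I r).
Local Notation policy := (exp_kl_ms I r m Theta).
Local Notation weight := (exp_kl_weight I r m Theta).

Lemma policy_ge0 t c w : 0 <= policy t c w.
Proof.
rewrite /exp_kl_ms; case: ifPn => _; first exact: ler0n.
by rewrite divr_ge0 ?sumr_ge0// => *; rewrite expR_ge0.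
Qed.

(** Round [c.+1] is an initial round whose policy is the point mass at [c], arms being numbered from
    0. *)
Lemma ae_first_pull c : (K <= T)%N -> {ae P, forall w, I c.+1 w = c}.
Proof.
move=> KT; have cT : (1 <= c.+1 <= T)%N by rewrite /= (leq_trans _ KT).
have [mI _ _] := PIr cT; have mc := mI c.
pose A := I c.+1 @^-1` [set c].
have PA : P A = 1%E.
  rewrite -[X in P X]setTI (Pp cT); last exact: historyT.
  under eq_integral do rewrite /exp_kl_ms ltn_ord eqxx.
  by rewrite integral_cst// mul1e; exact: probability_setT.
exists (~` A); split; [exact: measurableC| |by []].
by rewrite probability_setC// PA subee.
Qed.

(** The almost sure conditions under which the divergences in the weights are Bregman divergences of
    actual parameters. *)
Definition regular n w := forall c,
  [/\ (0 < pulls I n c w)%N, Theta (par (hat n c w)) &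
      mu (par (hat n c w)) = hat n c w].

Lemma ae_regular n : (K <= n <= T)%N -> {ae P, forall w, regular n w}.
Proof.
move=> /andP[Kn nT]; apply: filter_forall => c.
have nT1 : (1 <= n <= T)%N.
  by rewrite nT andbT (leq_trans _ Kn)// (leq_ltn_trans _ (ltn_ord c)).
have := ae_first_pull c (leq_trans Kn nT); have := emp_in c nT1.
apply: filterS2 => w Hc Ic; have pc : (0 < pulls I n c w)%N.
  apply: leq_trans (leq_pulls c w (leq_trans (ltn_ord c) Kn)).
  by rewrite pullsS Ic eqxx addn1.
by have [] := Hc pc.
Qed.

Section pointwise.
Variables (n : nat) (w : Omega) (c0 : 'I_K).
Hypotheses (Kn : (K <= n)%N) (reg : regular n w).

Let hat_le c : hat n c w <= hatmax n w.
Proof. by have [+ _] := fin_maxP (fun c => hat n c w) c0; apply. Qed.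

Let hatmaxE : exists c, hatmax n w = hat n c w.
Proof. by have [_ +] := fin_maxP (fun c => hat n c w) c0. Qed.

Lemma par_hatmax : Theta (par (hatmax n w)) /\ mu (par (hatmax n w)) = hatmax n w.
Proof. by have [c ->] := hatmaxE; have [] := reg c. Qed.

Lemma KL_hat c : KL m Theta (hat n c w) (hatmax n w) =
  kl (par (hat n c w)) (par (hatmax n w)).
Proof. by rewrite KLE//; [have [] := reg c|have [] := par_hatmax]. Qed.

Let pulls_ge1 c : (1 : R) <= (pulls I n c w)%:R.
Proof. by rewrite ler1n; have [] := reg c. Qed.

Lemma KL_hat_ge0 c : 0 <= kl (par (hat n c w)) (par (hatmax n w)).
Proof.
by apply: (bregman_ge0 mu_subgradient); [have [] := reg c|have [] := par_hatmax].
Qed.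

Let weight_le1 c : weight n.+1 c w <= 1.
Proof.
rewrite /exp_kl_weight /= KL_hat -[leRHS]expR0 ler_expR oppr_le0 mulr_ge0//.
  by rewrite /klms_L subr_ge0.
exact: KL_hat_ge0.
Qed.

(** The arm with the largest empirical mean has weight 1. Hence the policy never exceeds the
    weight. *)
Let sum_weight_ge1 : 1 <= \sum_c weight n.+1 c w.
Proof.
have [c hc] := hatmaxE.
have wc : weight n.+1 c w = 1.
  by rewrite /exp_kl_weight /= KL_hat hc bregmanxx mulr0 oppr0 expR0.
by rewrite (bigD1 c)//= wc lerDl sumr_ge0// => *; rewrite expR_ge0.
Qed.

Let policyE c : policy n.+1 c w = weight n.+1 c w / \sum_c weight n.+1 c w.
Proof. by rewrite /exp_kl_ms leqNgt ltnS Kn. Qed.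

Let sum_weight_gt0 : 0 < \sum_c weight n.+1 c w.
Proof. exact: lt_le_trans sum_weight_ge1. Qed.

Lemma policy_le_exp c u x : (u <= pulls I n c w)%N -> 0 <= x ->
  x <= kl (par (hat n c w)) (par (hatmax n w)) ->
  policy n.+1 c w <= expR (- ((u%:R - 1) * x)).
Proof.
move=> uc x0 xkl; rewrite policyE ler_pdivrMr//.
have E0 := expR_ge0 (- ((u%:R - 1) * x)).
apply: (@le_trans _ _ (expR (- ((u%:R - 1) * x)))); last by rewrite ler_peMr.
rewrite /exp_kl_weight /= KL_hat ler_expR lerN2 /klms_L.
have uc' : (u%:R : R) <= (pulls I n c w)%:R by rewrite ler_nat.
by have := pulls_ge1 c; nra.
Qed.

(* The weight of any arm is at most 1, so [policy a <= policy c / weight c]. *)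
Lemma policy_le_ratio a c : policy n.+1 a w <=
  expR ((pulls I n c w)%:R * kl (par (hat n c w)) (par (hatmax n w))) *
  policy n.+1 c w.
Proof.
rewrite !policyE mulrA ler_pM2r ?invr_gt0// (le_trans (weight_le1 a))//.
rewrite /exp_kl_weight /= KL_hat -expRD -[leLHS]expR0 ler_expR /klms_L.
by have := KL_hat_ge0 c; lra.
Qed.

(** The parameters of the empirical mean of [c], of the largest empirical mean, [th] and [theta c]
    are in increasing order; apply the three-point inequality twice and drop a nonnegative
    divergence. *)
Lemma KL_hat_le c th : Theta th -> th <= theta c -> hatmax n w < mu th ->
  par (hat n c w) <= theta c /\
  kl (par (hat n c w)) (par (hatmax n w)) <=
    kl (par (hat n c w)) (theta c) - kl th (theta c).
Proof.
move=> Tth thc hth; have [Tm mum] := par_hatmax; have [_ Tc muc] := reg c.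
have mth : par (hatmax n w) <= th.
  rewrite leNgt; apply/negP => /ltW h.
  by have := mu_nondecreasing mu_subgradient Tth Tm h; rewrite mum leNgt hth.
have cm : par (hat n c w) <= par (hatmax n w).
  have := hat_le c; rewrite le_eqVlt => /predU1P[->//|lt].
  rewrite leNgt; apply/negP => /ltW h.
  by have := mu_nondecreasing mu_subgradient Tm Tc h; rewrite mum muc leNgt lt.
have cth := le_trans cm mth.
split; first exact: le_trans thc.
have t1 := bregman_three_point mu_subgradient Tc Tth (theta_in c) cth thc.
have t2 := bregman_three_point mu_subgradient Tc Tm Tth cm mth.
have t3 := bregman_ge0 mu_subgradient Tm Tth.
lra.
Qed.

Lemma KL_hat_ge c x y : x <= y -> hat n c w <= x -> y <= hatmax n w ->
  (y - x) ^+ 2 / (8 * V) <= kl (par (hat n c w)) (par (hatmax n w)).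
Proof.
move=> xy cx ym; have [Tm mum] := par_hatmax; have [_ Tc muc] := reg c.
apply: le_trans (bregman_ge Theta_itv mu_subgradient mu_lipschitz0 Tc Tm V0).
rewrite ler_pM2r ?invr_gt0 ?mulr_gt0//; rewrite mum muc.
rewrite -[leRHS]sqrrN opprB ler_pXn2r ?nnegrE//; lra.
Qed.

End pointwise.

Lemma measurable_hist_emp_max_lt t n (y : R) : (n < t)%N ->
  measurable_fun (setT : set (@histType R d Omega K I r t))
    (fun w => hatmax n w < y).
Proof.
(* Without arms [fin_max] takes its default value 0; otherwise the maximum is below [y] exactly when
   every empirical mean is. *)
move=> nt; have [c0 _|K0] := pickP 'I_K; last first.
  have -> : (fun w => hatmax n w < y) = cst (0 < y).
    apply/funext => w; rewrite /emp_max /fin_max /=; congr (_ < y).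
    have -> : codom (fun c => hat n c w) = [::].
      by apply/eqP; rewrite -size_eq0 size_codom; apply/eqP/eq_card0.
    by rewrite big_nil.
  exact: measurable_cst.
have -> : (fun w => hatmax n w < y) =
    (fun w => \big[andb/true]_(c <- index_enum 'I_K) (hat n c w < y)).
  apply/funext => w; rewrite big_andE.
  have [h1 [c hc]] := fin_maxP (fun c => hat n c w) c0.
  apply/idP/forallP => [h c'|h].
    by apply: le_lt_trans h; exact: h1.
  by rewrite /emp_max hc; exact: h.
elim: (index_enum _) => [|c s IH].
  under eq_fun do rewrite big_nil; exact: measurable_cst.
under eq_fun do rewrite big_cons.
apply: measurable_and IH; apply: measurable_fun_ltr => //.
exact: measurable_hist_emp_mean.
Qed.

Lemma lr_eventE c (la e D : R) k n w : (0 < k)%N -> pulls I n c w = k ->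
  lr_event (I := I) (r := r) c la e k D n w <-> D <= k%:R * (la * hat n c w - e).
Proof.
move=> k0 nk; rewrite /lr_event /= nk eqxx /= /emp_mean -/(reward_sum n c w) nk.
have k0' : (k%:R : R) != 0 by rewrite pnatr_eq0 -lt0n.
suff -> : k%:R * (la * (reward_sum (I := I) (r := r) n c w / k%:R) - e) =
  la * reward_sum (I := I) (r := r) n c w - e * k%:R by [].
by field.
Qed.

(** * Decomposition of the pulls of a suboptimal arm, and summation over rounds *)

Section round_bound.
Variables (a c : 'I_K) (L q x y tp tm : R) (u J : nat) (ps : nat -> nat -> R).
Hypotheses (Ttp : Theta tp) (atp : theta a <= tp) (mutp : mu tp = x).
Hypothesis qtp : q <= kl tp (theta a).
Hypotheses (Ttm : Theta tm) (tmc : tm <= theta c) (mutm : mu tm = y).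
Hypothesis qtm : q <= kl tm (theta c).
Hypotheses (xy : x <= y) (u0 : (0 < u)%N) (uq : L <= u%:R * q) (q0 : 0 < q).
Hypothesis uL : L <= (u%:R - 1) * ((y - x) ^+ 2 / (8 * V)).
Hypothesis Tps : forall k j, Theta (ps k j).
Hypothesis ps0 : forall k, ps k 0 = theta c.
Hypothesis psP : forall k j ph, (0 < k)%N -> Theta ph -> ph <= theta c ->
  j%:R <= k%:R * kl ph (theta c) ->
  j%:R <= k%:R * ((ps k j - theta c) * mu ph - (b (ps k j) - b (theta c))).

(** A single parameter [tp] serves every count of [a]. For [c] the parameter [ps k j] varies: by
    [psP], the event occurs when [c] has [k] pulls, its empirical parameter is at most [theta c],
    and [k] times its divergence to [theta c] reaches [j]. *)
Let lr_above k n := lr_event (I := I) (r := r) a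
  (tp - theta a) (b tp - b (theta a)) k L n.
Let lr_below k j n := lr_event (I := I) (r := r) c
  (ps k j - theta c) (b (ps k j) - b (theta c)) k j%:R n.
Let pull c t : set Omega := [set w | I t w == c].

Let pull_hist c' t : (0 < t)%N -> history I r t.+1 (pull c' t).
Proof. by move=> t0; apply: history_set; apply: measurable_hist_I; rewrite t0/=. Qed.

Section fixed_round.
Variable n : nat.
Hypotheses (Kn : (K <= n)%N) (nT : (n < T)%N).

Let measurable_hist1 (E : set Omega) : history I r n.+1 E -> measurable E.
Proof. by move=> hE; apply: (history_measurable PIr _ hE); exact: leqW. Qed.

Let mpull c' : measurable (pull c' n.+1).
Proof.
by apply: (history_measurable PIr (t := n.+2)) => //; exact: pull_hist.
Qed.

Let reg_ae : {ae P, forall w, regular n w}.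
Proof. by apply: ae_regular; rewrite Kn ltnW. Qed.

Let n1T : (1 <= n.+1 <= T)%N.
Proof. exact: nT. Qed.

Let few := [set w | (pulls I n a w < u)%N].
Let ordered := [set w | [&& (u <= pulls I n a w)%N, hat n a w <= x &
                            ~~ (hatmax n w < y)]].
Let above := [set w | (u <= pulls I n a w)%N && (x < hat n a w)].
Let below := [set w | hatmax n w < y].

Let mpulls_lt c' k : history I r n.+1 [set w | (pulls I n c' w < k)%N].
Proof.
by apply: history_set; apply: measurable_fun_ltn => //; exact: measurable_hist_pulls.
Qed.

Let mpulls_ge c' k : measurable_fun
  (setT : set (@histType R d Omega K I r n.+1)) (fun w => k <= pulls I n c' w)%N.
Proof. by apply: measurable_fun_leq => //; exact: measurable_hist_pulls. Qed.

Let hist_ordered : history I r n.+1 ordered.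
Proof.
apply: history_set; apply: measurable_and => //; apply: measurable_and.
  by apply: measurable_fun_ler => //; exact: measurable_hist_emp_mean.
by apply: measurable_neg; exact: measurable_hist_emp_max_lt.
Qed.

Let hist_above : history I r n.+1 above.
Proof.
apply: history_set; apply: measurable_and => //.
by apply: measurable_fun_ltr => //; exact: measurable_hist_emp_mean.
Qed.

Let hist_below : history I r n.+1 below.
Proof. by apply: history_set; exact: measurable_hist_emp_max_lt. Qed.

Let P_ordered : (P (ordered `&` pull a n.+1) <= (expR (- L))%:E)%E.
Proof.
apply: (policy_le PIr policy_ge0 Pp n1T hist_ordered); first exact: expR_gt0.
move: reg_ae; apply: filterS => w reg /and3P[uw ax ym].
have xkl := KL_hat_ge a reg xy ax; rewrite -leNgt in ym.
apply: le_trans (policy_le_exp a Kn reg uw _ (xkl ym)) _.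
  by rewrite divr_ge0 ?sqr_ge0// mulr_ge0// ltW.
by rewrite ler_expR lerN2.
Qed.

(** The log-likelihood ratio per pull is nondecreasing in the empirical mean and equals
    [kl tp (theta a) >= q] at [x]; after at least [u] pulls the total reaches [L]. *)
Let P_above : (P (above `&` pull a n.+1) <=
  \sum_(1 <= k < T.+1) P (pull a n.+1 `&` lr_above k n))%E.
Proof.
apply: probability_le_cover.
- by apply: measurableI => //; exact: measurable_hist1.
- move=> k _; apply: measurableI => //; apply: measurable_hist1.
  exact: lr_event_measurable.
move: reg_ae; apply: filterS => w reg [/andP[uw xw] aw].
have [k0 _ _] := reg a.
exists (pulls I n a w).
  by rewrite k0/= ltnS (leq_trans (leq_pulls_id _ _ _))// ltnW.
split => //; apply/(lr_eventE _ _ _ k0) => //.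
rewrite (le_trans uq)//; have uw' : (u%:R : R) <= (pulls I n a w)%:R by rewrite ler_nat.
apply: (@le_trans _ _ ((pulls I n a w)%:R * kl tp (theta a))).
  by apply: ler_pM => //; exact: ltW.
rewrite ler_wpM2l//; move: xw; rewrite -mutp /bregman => xw.
have : 0 <= (tp - theta a) * (hat n a w - mu tp).
  by rewrite mulr_ge0 ?subr_ge0// ltW.
lra.
Qed.

(** The layers are cut by likelihood-ratio events: holding at [j] gives the probability bound, and
    failing at [j.+1] bounds [k] times the divergence to [theta c] by [j.+1]. *)
Let layer k j := [set w | [&& hatmax n w < y, w \in lr_below k j n &
  w \notin lr_below k j.+1 n]].

Let hist_layer k j : history I r n.+1 (layer k j).
Proof.
have -> : layer k j = below `&` (lr_below k j n `&` ~` lr_below k j.+1 n).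
  apply/seteqP; split => w.
    by move=> /and3P[yw /set_mem wj /negP wj1]; split => //; split => // /mem_set.
  move=> [yw [wj wj1]]; apply/and3P; split => //; first exact: mem_set.
  by apply/negP => /set_mem.
have mlr i : @measurable _ (@histType R d Omega K I r n.+1) (lr_below k i n).
  exact: lr_event_measurable.
have mbel : @measurable _ (@histType R d Omega K I r n.+1) below.
  exact: hist_below.
exact: (measurableI _ _ mbel (measurableI _ _ (mlr j) (measurableC (mlr j.+1)))).
Qed.

(** By [KL_hat_le], [k] times the divergence of [c] to the largest empirical mean is below
    [j.+1 - k * q] on the layer; [policy_le_ratio] turns this into a comparison of the two arms. *)
Let P_layer k j : (0 < k)%N -> (P (layer k j `&` pull a n.+1) <=
  (expR (j.+1%:R - k%:R * q))%:E * P (pull c n.+1 `&` lr_below k j n))%E.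
Proof.
move=> k0.
apply: (@le_trans _ _ ((expR (j.+1%:R - k%:R * q))%:E *
    P (layer k j `&` pull c n.+1))%E); last first.
  rewrite lee_wpmul2l ?lee_fin ?expR_ge0// le_measure ?inE//.
  - by apply: measurableI => //; exact: measurable_hist1 (hist_layer k j).
  - by apply: measurableI => //; apply: measurable_hist1; exact: lr_event_measurable.
  - by move=> w [/and3P[_ /set_mem wj _] cw].
apply: (policy_le_scale PIr policy_ge0 Pp n1T (hist_layer k j)).
  exact: expR_gt0.
move: reg_ae; apply: filterS => w reg /and3P[ym /set_mem wj wj1].
have nk : pulls I n c w = k by move: wj => /andP[/eqP].
rewrite (le_trans (policy_le_ratio c Kn reg a c))// ler_wpM2r ?policy_ge0//.
rewrite -mutm in ym; have [hc klc] := KL_hat_le c reg Ttm tmc ym.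
have [_ Tc muc] := reg c.
rewrite ler_expR nk.
have k0' : (0 : R) < k%:R by rewrite ltr0n.
have lt : k%:R * kl (par (hat n c w)) (theta c) < j.+1%:R.
  rewrite ltNge; apply/negP => /(psP k0 Tc hc); rewrite muc => h.
  by move: wj1; rewrite mem_set//; apply/(lr_eventE _ _ _ k0 nk).
have := ler_wpM2l (ltW k0') klc; have := ler_wpM2l (ltW k0') qtm.
rewrite mulrBr; lra.
Qed.

Let P_below : (P (below `&` pull a n.+1) <= \sum_(1 <= k < T.+1)
  ((expR (- J%:R))%:E + \sum_(0 <= j < J) (expR (j.+1%:R - k%:R * q))%:E *
     P (pull c n.+1 `&` lr_below k j n)))%E.
Proof.
pose B k := below `&` pull a n.+1 `&` [set w | (pulls I n c w == k)%N].
have mB k : measurable (B k).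
  apply: measurableI.
    by apply: measurableI => //; exact: measurable_hist1.
  apply: measurable_hist1; apply: history_set.
  by apply: measurable_fun_eqn => //; exact: measurable_hist_pulls.
apply: (@le_trans _ _ (\sum_(1 <= k < T.+1) P (B k))%E).
  apply: probability_le_cover => //.
    by apply: measurableI => //; exact: measurable_hist1.
  move: reg_ae; apply: filterS => w reg Bw; have [k0 _ _] := reg c.
  exists (pulls I n c w); last by split => //=.
  by rewrite k0/= ltnS (leq_trans (leq_pulls_id _ _ _))// ltnW.
rewrite big_nat_cond [leRHS]big_nat_cond; apply: lee_sum => k /andP[/andP[k0 _] _].
(* Index [J] collects all that lies beyond the last layer; its probability is at most [expR (- J)]
   whatever arm is pulled. *)
pose C j := if (j < J)%N then layer k j `&` pull a n.+1 else lr_below k J n.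
have mlr j : measurable (lr_below k j n).
  by apply: measurable_hist1; exact: lr_event_measurable.
have mlayer j : measurable (layer k j) by exact: measurable_hist1 (hist_layer k j).
apply: (@le_trans _ _ (\sum_(0 <= j < J.+1) P (C j))%E).
  apply: probability_le_cover => //.
    by move=> j _; rewrite /C; case: ifPn => // _; exact: measurableI.
  apply/aeW => w [[bw aw] /= /eqP nk].
  have w0 : lr_below k 0 n w.
    by apply/(lr_eventE _ _ _ k0 nk); rewrite ps0 !subrr mul0r subrr mulr0.
  have [wJ|wJ] := boolP (w \in lr_below k J n).
    by exists J => //; rewrite /C ltnn; exact: set_mem.
  suff [j jJ [h1 h2]] : exists2 j, (j < J)%N &
      w \in lr_below k j n /\ w \notin lr_below k j.+1 n.
    by exists j; [exact: leqW|rewrite /C jJ; split => //; apply/and3P].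
  (* Level 0 holds because [ps k 0 = theta c] makes the ratio trivial, and level [J] fails, so some
     level holds whose successor fails. *)
  elim: J wJ => [|J' IH] wJ; first by rewrite mem_set in wJ.
  have [wJ'|/IH[j jJ' H]] := boolP (w \in lr_below k J' n).
    by exists J'.
  by exists j => //; exact: leqW.
rewrite big_nat_recr//= addeC leeD//.
  rewrite /C ltnn; apply: (lr_event_probability PIr (a := c)); last exact: ltnW.
  exact: likelihood_ratio1.
rewrite big_nat_cond [leRHS]big_nat_cond; apply: lee_sum => j /andP[/andP[_ jJ] _].
by rewrite /C jJ; exact: P_layer.
Qed.

Lemma P_pull_round : (P (pull a n.+1) <=
  P (pull a n.+1 `&` few) + ((expR (- L))%:E +
  (\sum_(1 <= k < T.+1) P (pull a n.+1 `&` lr_above k n) +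
   \sum_(1 <= k < T.+1)
    ((expR (- J%:R))%:E + \sum_(0 <= j < J) (expR (j.+1%:R - k%:R * q))%:E *
     P (pull c n.+1 `&` lr_below k j n)))))%E.
Proof.
pose B i := nth set0 [:: pull a n.+1 `&` few; ordered `&` pull a n.+1;
  above `&` pull a n.+1; below `&` pull a n.+1] i.
have mfew : measurable few by apply: measurable_hist1; exact: mpulls_lt.
have mo : measurable ordered by exact: measurable_hist1.
have ma : measurable above by exact: measurable_hist1.
have mb : measurable below by exact: measurable_hist1.
apply: (@le_trans _ _ (\sum_(0 <= i < 4) P (B i))%E).
  apply: probability_le_cover => //.
    by move=> [|[|[|[|i]]]]// _; exact: measurableI.
  apply/aeW => w aw; have [uw|uw] := ltnP (pulls I n a w) u.
    by exists 0%N.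
  have [ym|ym] := boolP (hatmax n w < y); first by exists 3%N.
  have [ax|xa] := leP (hat n a w) x.
    by exists 1%N => //; split => //; apply/and3P.
  by exists 2%N => //; split => //; apply/andP.
rewrite 4?big_nat_recl// big_geq// adde0 /B /=.
by rewrite leeD2l// leeD// leeD.
Qed.

End fixed_round.
Let P_pull_init t : (1 <= t <= T)%N -> (t <= K)%N ->
  (P (pull a t) <= ((a.+1 == t)%:R)%:E)%E.
Proof.
move=> tT tK.
have -> : pull a t = setT `&` I t @^-1` [set a].
  by rewrite setTI; apply/seteqP; split => w /= /eqP.
rewrite (Pp tT); last exact: historyT.
under eq_integral do rewrite /exp_kl_ms tK.
by rewrite integral_cst// [X in (_ * X)%E](_ : _ = 1%E) ?mule1//; exact: probability_setT.
Qed.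

Let mpull_le t : (1 <= t < T.+1)%N -> measurable (pull a t).
Proof.
move=> /andP[t1 tT]; apply: (history_measurable PIr (t := t.+1)) => //.
exact: pull_hist.
Qed.

Let P_few : (\sum_(1 <= t < T.+1)
  P (pull a t `&` [set w | (pulls I t.-1 a w < u)%N]) <= (u%:R)%:E)%E.
Proof.
have -> : ((u%:R)%:E = \int[P]_w (u%:R)%:E :> \bar R)%E.
  rewrite integral_cst// [X in (_ * X)%E](_ : _ = 1%E) ?mule1//.
  exact: probability_setT.
apply: (@sum_probability_le _ _ _ P T _ (fun=> u%:R)) => //.
  move=> t /[dup] tT /andP[t1 _]; apply: measurableI; first exact: mpull_le.
  have tT' : (t <= T.+1)%N by case/andP: tT => _ /ltnW.
  apply: (history_measurable PIr tT'); apply: history_set.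
  apply: measurable_fun_ltn => //; apply: measurable_hist_pulls.
  by rewrite prednK.
move=> w; apply: (@le_trans _ _
  (\sum_(1 <= t < T.+1) ((I t w == a) && (pulls I t.-1 a w < u)) : nat)%:R).
  rewrite natr_sum; apply: ler_sum => s _; rewrite indicE.
  case: (boolP (w \in _)) => [|_]; last by rewrite ler0n.
  by rewrite inE => -[/= -> ->].
by rewrite sum_pull_before_count ler_nat geq_minl.
Qed.

(** The terms correspond, in order, to the initial rounds, few pulls of [a], correctly ordered
    empirical means, an overestimated [a], and an underestimated maximum beyond and within the [J]
    layers. *)
Lemma sum_pull_probability : (\sum_(1 <= t < T.+1) P (pull a t) <=
  (1 + (u%:R + (T%:R * expR (- L) + (T%:R * expR (- L) +
   (T%:R * (T%:R * expR (- J%:R)) + J%:R * expR 1 / q)))))%:E)%E.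
Proof.
pose f1 t : \bar R := ((a.+1 == t)%:R)%:E.
pose f2 t : \bar R := P (pull a t `&` [set w | (pulls I t.-1 a w < u)%N]).
pose f3 (t : nat) : \bar R := (expR (- L))%:E.
pose f4 t : \bar R := (\sum_(1 <= k < T.+1) P (pull a t `&` lr_above k t.-1))%E.
pose f5 (t : nat) : \bar R := (\sum_(1 <= k < T.+1) (expR (- J%:R))%:E)%E.
pose f6 t : \bar R := (\sum_(1 <= k < T.+1) \sum_(0 <= j < J)
  (expR (j.+1%:R - k%:R * q))%:E * P (pull c t `&` lr_below k j t.-1))%E.
have g0 : (forall t, 0 <= f2 t)%E /\ (forall t, 0 <= f3 t)%E /\
   (forall t, 0 <= f4 t)%E /\ (forall t, 0 <= f5 t)%E /\ (forall t, 0 <= f6 t)%E.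
  split; first by move=> t; exact: measure_ge0.
  split; first by move=> t; rewrite lee_fin expR_ge0.
  split; first by move=> t; apply: sume_ge0 => k _; exact: measure_ge0.
  split; first by move=> t; apply: sume_ge0 => k _; rewrite lee_fin expR_ge0.
  move=> t; apply: sume_ge0 => k _; apply: sume_ge0 => j _.
  by apply: mule_ge0; rewrite ?lee_fin ?expR_ge0.
have [f20 [f30 [f40 [f50 f60]]]] := g0.
apply: (@le_trans _ _ (\sum_(1 <= t < T.+1)
    (f1 t + (f2 t + (f3 t + (f4 t + (f5 t + f6 t))))))%E).
  rewrite big_nat_cond [leRHS]big_nat_cond; apply: lee_sum => t /andP[/andP[t1 tT] _].
  have [tK|Kt] := leqP t K.
    rewrite (@le_trans _ _ (f1 t))//; first by apply: P_pull_init => //; rewrite t1.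
    by rewrite leeDl// !adde_ge0.
  case: t t1 tT Kt => // n _ nT Kn.
  apply: (le_trans (P_pull_round Kn nT)).
  rewrite [in leLHS]big_split /=.
  by rewrite leeDr// lee_fin.
rewrite !big_split /= !EFinD.
have T1 : (\sum_(1 <= t < T.+1) f1 t <= 1%:E)%E.
  rewrite sumEFin lee_fin -natr_sum lern1.
  have -> : (\sum_(1 <= t < T.+1) (a.+1 == t) =
      \sum_(1 <= t < T.+1 | a.+1 == t) 1)%N.
    by rewrite [RHS]big_mkcond; apply: eq_bigr => t _; case: eqP.
  rewrite sum1_count; have -> : count (fun t => a.+1 == t) (index_iota 1 T.+1) =
      count_mem a.+1 (index_iota 1 T.+1) by apply: eq_count => t; rewrite /= eq_sym.
  by rewrite count_uniq_mem ?iota_uniq// leq_b1.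
have T3 z : \sum_(1 <= t < T.+1) z = T%:R * z :> R.
  by rewrite sumr_const_nat subn1 mulr_natl.
apply: leeD => //; apply: leeD; first exact: P_few.
apply: leeD; first by rewrite sumEFin lee_fin T3.
apply: leeD.
  (* With the sum over rounds inside, each of the [T] counts costs [expR (- L)] only once. *)
  rewrite exchange_big/= -T3 -sumEFin; apply: lee_sum => k _.
  apply: (lr_event_pull_probability PIr) => //; exact: likelihood_ratio1.
apply: leeD.
  by under eq_bigr do rewrite /f5 sumEFin T3; rewrite sumEFin lee_fin T3.
rewrite exchange_big /=; under eq_bigr do rewrite exchange_big /=.
apply: (@le_trans _ _ (\sum_(1 <= k < T.+1)
    (J%:R * expR 1 * expR (- (k%:R * q)))%:E)%E); last first.
  rewrite sumEFin lee_fin -mulr_sumr ler_wpM2l ?mulr_ge0 ?expR_ge0//.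
  exact: sum_expR_geometric_le.
apply: lee_sum => k _.
apply: (@le_trans _ _ (\sum_(0 <= j < J) (expR 1 * expR (- (k%:R * q)))%:E)%E).
  (* The cost [expR j.+1] of a layer meets the bound [expR (- j)] on the expected pulls in it, which
     leaves [expR 1 * expR (- (k * q))] for every [j]. *)
  apply: lee_sum => j _; rewrite -ge0_sume_distrr; last by move=> t _; exact: measure_ge0.
  apply: (@le_trans _ _ ((expR (j.+1%:R - k%:R * q))%:E * (expR (- j%:R))%:E)%E).
    rewrite lee_wpmul2l ?lee_fin ?expR_ge0//.
    apply: (lr_event_pull_probability PIr) => //; exact: likelihood_ratio1.
  rewrite -EFinM lee_fin -!expRD ler_expR -natr1; lra.
by rewrite sumEFin lee_fin sumr_const_nat subn0 -[leLHS]mulr_natl mulrA.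
Qed.

End round_bound.

(** The 6 collects four terms bounded by 1 and the rounding of [u] by 2; 128 is the factor in
    [L / q], which occurs once through [u] and [(2 + (ln 2)^-1) * expR 1] times through the
    layers. *)
Definition pull_constant : R := 6 + 128 * (1 + (2 + (ln 2)^-1) * expR 1).

Lemma arm_pull_probability (a c : 'I_K) : (0 < T)%N ->
  mu (theta a) < mu (theta c) ->
  (\sum_(1 <= t < T.+1) P [set w | I t w == a] <=
   (pull_constant *
     (V * ln T%:R / (mu (theta c) - mu (theta a)) ^+ 2 + 1))%:E)%E.
Proof.
move=> T0 ac; set D := mu (theta c) - mu (theta a).
have D0 : 0 < D by rewrite subr_gt0.
have V8 : 0 < 8 * V by rewrite mulr_gt0.
pose q := (D / 4) ^+ 2 / (8 * V).
have q0 : 0 < q by rewrite divr_gt0// exprn_gt0// divr_gt0.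
pose L : R := ln T%:R.
have TR : (1 : R) <= T%:R by rewrite ler1n.
have L0 : 0 <= L by rewrite ln_ge0.
have TL : expR (- L) = T%:R^-1 by rewrite expRN lnK// posrE (lt_le_trans _ TR).
have TL1 : T%:R * expR (- L) = 1.
  by rewrite TL mulfV// gt_eqF// (lt_le_trans _ TR).
have le_ac : theta a <= theta c.
  rewrite leNgt; apply/negP => /ltW h.
  have := mu_nondecreasing mu_subgradient (theta_in c) (theta_in a) h.
  by rewrite leNgt ac.
have ivt := mu_ivt Theta_itv mu_subgradient mu_lipschitz0 (theta_in a) (theta_in c) le_ac.
have [|tp [Ttp /andP[atp _] mutp]] := ivt (mu (theta a) + D / 4).
  by rewrite /D; apply/andP; split; lra.
have [|tm [Ttm /andP[_ tmc] mutm]] := ivt (mu (theta c) - D / 4).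
  by rewrite /D; apply/andP; split; lra.
have kl_ge := bregman_ge Theta_itv mu_subgradient mu_lipschitz0.
have qtp : q <= kl tp (theta a).
  by have := kl_ge _ _ Ttp (theta_in a) V0; rewrite mutp addrAC subrr add0r.
have qtm : q <= kl tm (theta c).
  have := kl_ge _ _ Ttm (theta_in c) V0.
  by rewrite mutm addrAC subrr add0r sqrrN.
(* One unit rounds up, the other makes up for [klms_L k = k - 1]. *)
pose u := (Num.truncn (L / q)).+2.
have Lq0 : 0 <= L / q by rewrite divr_ge0// ltW.
have /andP[u1 u2] := truncn_itv Lq0.
have uL : L <= (u%:R - 1) * q.
  by rewrite -ler_pdivrMr// /u -natr1 addrK ltW.
(* [J >= 2 ln T] makes [T ^ 2 * expR (- J)] at most 1. Rounding up costs 1, which is at most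
   [ln T / ln 2] when [T >= 2]; for [T = 1] take [J = 0]. *)
have [J J1 J2] : exists2 J : nat, 2 * L <= J%:R & J%:R <= (2 + (ln 2)^-1) * L.
  case: (ltnP 1 T) => [T1|T1].
    have L2 : ln 2 <= L by rewrite /L ler_ln ?posrE ?ltr0n// ler_nat.
    have l2 : 0 < ln 2 :> R by rewrite ln_gt0// ltr1n.
    have L20 : 0 <= 2 * L by rewrite mulr_ge0.
    have /andP[j1 j2] := truncn_itv L20.
    exists (Num.truncn (2 * L)).+1; first exact: ltW.
    rewrite -[leLHS]natr1 [leRHS]mulrDl lerD// -(ler_pM2l l2) mulr1 mulrA mulfV ?mul1r//.
    by rewrite gt_eqF.
  exists 0%N.
    have -> : L = 0 by rewrite /L (_ : T = 1%N) ?ln1//; apply/eqP; rewrite eqn_leq T1.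
    by rewrite mulr0.
  by rewrite mulr_ge0// addr_ge0// invr_ge0 ln_ge0// ler1n.
have TJ : (T%:R : R) * (T%:R * expR (- J%:R)) <= 1.
  apply: (@le_trans _ _ (T%:R * (T%:R * (expR (- L) * expR (- L))))).
    rewrite !ler_wpM2l// -expRD ler_expR; lra.
  rewrite (_ : T%:R * _ = (T%:R * expR (- L)) * (T%:R * expR (- L))); last by ring.
  by rewrite TL1 mulr1.
(* The level is [j / k] for the pair [(k, j)]. It vanishes for [j = 0], which yields [ps0]. *)
have lev (kj : nat * nat) := bregman_level Theta_itv mu_subgradient mu_lipschitz0
  (theta_in c) V0 (divr_ge0 (ler0n R kj.2) (ler0n R kj.1)).
have /choice[ps psP] := lev.
have xy : mu (theta a) + D / 4 <= mu (theta c) - D / 4 by rewrite /D; lra.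
have uq : L <= u%:R * q by lra.
have uL4 : L <= (u%:R - 1) *
    ((mu (theta c) - D / 4 - (mu (theta a) + D / 4)) ^+ 2 / (8 * V)).
  (* The two intermediate means are at distance [D / 2], twice the distance that defines [q]. *)
  rewrite (_ : _ ^+ 2 / _ = 4 * q); last first.
    by rewrite /q /D; field; rewrite gt_eqF.
  have : 0 <= (u%:R - 1) * q by exact: le_trans uL.
  lra.
apply: le_trans (@sum_pull_probability a c L q (mu (theta a) + D / 4)
  (mu (theta c) - D / 4) tp tm u J (fun k j => ps (k, j)) Ttp atp mutp qtp
  Ttm tmc mutm qtm xy uq q0 uL4 _ _ _) _.
- by move=> k j; have [] := psP (k, j).
- by move=> k; have [_ + _] := psP (k, 0%N); apply; rewrite mul0r.
- move=> k j ph k0 Tph phc; have k0' : (0 : R) < k%:R by rewrite ltr0n.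
  rewrite -!ler_pdivrMl// mulrC => h.
  by have [_ _ +] := psP (k, j); apply.
rewrite lee_fin.
rewrite TL1.
have uLq : u%:R <= L / q + 2 by rewrite /u -natr1 -natr1; lra.
have JLq : J%:R * expR 1 / q <= (2 + (ln 2)^-1) * expR 1 * (L / q).
  rewrite [leRHS](_ : _ = (2 + (ln 2)^-1) * L * expR 1 / q); last by ring.
  apply: ler_wpM2r; first by rewrite invr_ge0 ltW.
  by apply: ler_wpM2r => //; exact: expR_ge0.
have LqE : L / q = 128 * (V * L / D ^+ 2).
  by rewrite /q; field; rewrite !gt_eqF.
have l2 : 0 <= (ln 2)^-1 :> R by rewrite invr_ge0 ln_ge0// ler1n.
have E1 : 0 <= (2 + (ln 2)^-1) * expR 1 :> R.
  by rewrite mulr_ge0 ?expR_ge0// addr_ge0.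
move: E1 JLq; rewrite /pull_constant; set E := (2 + _) * expR 1 => E1 JLq.
have W0 : 0 <= V * L / D ^+ 2 by move: Lq0; rewrite LqE pmulr_rge0.
rewrite LqE in uLq JLq; rewrite -/L.
move: W0 uLq JLq TJ; move: (V * L / D ^+ 2) => W W0 uLq JLq TJ.
have EW : 0 <= E * W by exact: mulr_ge0.
lra.
Qed.

End exp_kl_ms_round.

(** * From expected numbers of pulls to the regret *)

Theorem corollary7 (R : realType) :
  exists2 C : R, 0 < C &
  forall (m : {measure set R -> \bar R}) (Theta : set R) (Vbar : R)
    (K T : nat) (nu : 'I_K -> probability R R)
    (d : measure_display) (Omega : measurableType d) (P : probability Omega R)
    (I : nat -> Omega -> 'I_K) (r : nat -> Omega -> R),
  (2 <= K)%N -> (1 <= T)%N ->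
  is_expfam m Theta ->
  C2_pos_within Theta (log_partition m) ->
  (forall rho, expfam_set m Theta rho -> ('V_rho[id] <= Vbar%:E)%E) ->
  (forall a, expfam_set m Theta (nu a)) ->
  bandit_interaction P I r nu T ->
  emp_means_in_family P I r m Theta T ->
  follows_policy P I r (exp_kl_ms I r m Theta) T ->
  (regret P I nu T <=
    (C * \sum_(a < K | 0 < gap nu a)
           (Vbar * ln T%:R / gap nu a + gap nu a))%:E)%E.
Proof.
have l2 : 0 <= (ln 2)^-1 :> R by rewrite invr_ge0 ln_ge0// ler1n.
exists (pull_constant (R := R)).
  rewrite /pull_constant ltr_wpDr// mulr_ge0// addr_ge0//.
  by rewrite mulr_ge0 ?expR_ge0// addr_ge0.
move=> m Theta V K T nu d Omega P I r K2 T1 mT _ VT nuT PIr emp Pp.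
pose c0 : 'I_K := Ordinal (ltn_trans (ltnSn 0) K2).
have [gap_le [best bestE]] := fin_maxP (fun c => mean (nu c)) c0.
have gapE a : gap nu a = mean (nu best) - mean (nu a) by rewrite /gap bestE.
have gap0 a : 0 <= gap nu a by rewrite /gap subr_ge0.
have /choice[theta thetaP] : forall a, exists th, Theta th /\ expfam m th = nu a.
  by move=> a; have [th Tth e] := nuT a; exists th.
have [b bE] : exists b : R -> R, log_partition m = b by exists (log_partition m).
have [mu muE] : exists mu : R -> R, forall th, mean (expfam m th) = mu th.
  by exists (fun th => mean (expfam m th)).
have [s sE] : exists s : R -> R, forall th,
    fine (\int[expfam m th]_x (x ^+ 2)%:E) = s th.
  by exists (fun th => fine (\int[expfam m th]_x (x ^+ 2)%:E)).
have Theta_itv x y z : Theta x -> Theta y -> x <= z <= y -> Theta z.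
  by move=> Tx Ty; exact: mT.1.
have mu_sub := mean_subgradient mT VT bE muE sE.
have mu_lip := mean_lipschitz0 mT VT bE muE sE.
have theta_in a : Theta (theta a) by have [] := thetaP a.
have muE' a : mean (nu a) = mu (theta a) by have [_ <-] := thetaP a; rewrite muE.
have KLE := KL_bregman mT VT bE muE sE.
have lr1 c ps : Theta ps ->
    (\int[nu c]_x (expR ((ps - theta c) * x - (b ps - b (theta c))))%:E = 1)%E.
  by move=> Tps; have [_ <-] := thetaP c; exact: (likelihood_ratio_integral mT bE).
have emp_in t c : (1 <= t <= T)%N -> {ae P, forall w, (0 < pulls I t c w)%N ->
    Theta (param_of_mean m Theta (emp_mean I r t c w)) /\
    mu (param_of_mean m Theta (emp_mean I r t c w)) = emp_mean I r t c w}.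
  move=> tT; have := emp t c tT; apply: filterS => w H /H.
  exact: param_of_meanP.
have arm a : 0 < gap nu a -> (\sum_(1 <= t < T.+1) P [set w | I t w == a] <=
    (pull_constant (R := R) * (V * ln T%:R / gap nu a ^+ 2 + 1))%:E)%E.
  rewrite gapE !muE' subr_gt0 => ac.
  have le_ac : theta a <= theta best.
    rewrite leNgt; apply/negP => /ltW h.
    have := mu_nondecreasing mu_sub (theta_in best) (theta_in a) h.
    by rewrite leNgt ac.
  (* Two members with distinct means force a positive variance bound, by the Lipschitz property of
     the mean. *)
  have V0 : 0 < V.
    have := mu_lipschitz Theta_itv mu_sub mu_lip (theta_in a) (theta_in best) le_ac.
    by nra.
  exact: (arm_pull_probability PIr Pp Theta_itv mu_sub mu_lip V0 KLE theta_in lr1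
    emp_in T1 ac).
have mI t a : (1 <= t < T.+1)%N -> measurable [set w | I t w == a].
  move=> tT; have [mIt _ _] := PIr t tT.
  have -> : [set w | I t w == a] = I t @^-1` [set a].
    by apply/seteqP; split => w /= /eqP.
  exact: mIt.
(* Regret decomposition: each arm contributes its gap times its expected number of pulls, and arms
   with zero gap contribute nothing. *)
have -> : regret P I nu T =
    (\sum_a (gap nu a)%:E * \sum_(1 <= t < T.+1) P [set w | I t w == a])%E.
  pose F t a : set Omega := if (1 <= t < T.+1)%N then [set w | I t w == a] else set0.
  have mF t a : measurable (F t a) by rewrite /F; case: ifPn => // /mI.
  have mg t a : measurable_fun setT (fun w => (gap nu a)%:E * (\1_(F t a) w)%:E)%E.
    by apply: emeasurable_funM => //; apply/measurable_EFinP.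
  have g0 t a w : (0 <= (gap nu a)%:E * (\1_(F t a) w)%:E)%E.
    by rewrite mule_ge0// lee_fin.
  rewrite /regret expectation.unlock.
  transitivity (\int[P]_w \sum_(1 <= t < T.+1) \sum_a
      (gap nu a)%:E * (\1_(F t a) w)%:E)%E.
    apply: eq_integral => w _; rewrite -sumEFin; apply: eq_big_nat => t tT.
    rewrite (bigD1 (I t w))//= big1 => [|a aI].
      by rewrite indicE /F tT mem_set/= ?mule1 ?adde0.
    rewrite indicE /F tT memNset ?mule0//= => /eqP e.
    by rewrite e eqxx in aI.
  rewrite ge0_integral_sum//; last 2 first.
  - by move=> t; apply: emeasurable_sum => a; exact: mg.
  - by move=> t w _; apply: sume_ge0.
  transitivity (\sum_(1 <= t < T.+1) \sum_a
      (gap nu a)%:E * P [set w | I t w == a])%E.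
    apply: eq_big_nat => t tT; rewrite ge0_integral_sum//.
    apply: eq_bigr => a _; rewrite ge0_integralZl//.
    - by rewrite integral_indic// setIT /F tT.
    - exact/measurable_EFinP.
    - by rewrite lee_fin.
  rewrite exchange_big /=; apply: eq_bigr => a _.
  by rewrite ge0_sume_distrr.
rewrite mulr_sumr [in leRHS]big_mkcond -sumEFin; apply: lee_sum => a _.
case: ifPn => [ga|]; last first.
  rewrite -leNgt => ga; have -> : gap nu a = 0.
    by apply/eqP; rewrite eq_le ga gap0.
  by rewrite mul0e.
apply: (le_trans (lee_wpmul2l _ (arm a ga))); first by rewrite lee_fin.
rewrite -EFinM lee_fin.
have -> : gap nu a * (pull_constant (R := R) * (V * ln T%:R / gap nu a ^+ 2 + 1)) =
    pull_constant (R := R) * (V * ln T%:R / gap nu a + gap nu a).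
  by field; rewrite gt_eqF.
by [].
Qed.
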